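(* Let $(D,S)$ and $(D',S')$ be Dyer systems (with finite generating sets, possibly of different cardinalities) such that $(D,S)\preceq(D',S')$. Then $a_{(D,S)}(m)\le a_{(D',S')}(m)$ for all integers $m\ge 0$. In particular, $\tau(D,S)\le\tau(D',S')$.
   Context: **Growth.** For a group $G$ with finite generating set $S$, $|x|_S$ is the word length of $x\in G$ with respect to $S\cup S^{-1}$; $a_{(G,S)}(m)=\#\{x\in G: |x|_S=m\}$, $b_{(G,S)}(m)=\#\{x\in G:|x|_S\le m\}$, and the growth rate is $\tau(G,S)=\lim_{m\to\infty}\sqrt[m]{b_{(G,S)}(m)}$ (the limit exists). **Dyer systems.** Let $\widehat{\mathbb{N}}=\mathbb{N}\cup\{\infty\}$ and $[a,b]_k=aba\cdots$ ($k$ alternating factors). A pair $(D,S)$ with $D$ a group generated by $S=\{s_1,\dots,s_n\}$ is a Dyer system if $D$ admits a presentation $$D=\langle s_1,\dots,s_n\mid s_i^{f_i}=1,\ [s_i,s_j]_{m_{ij}}=[s_j,s_i]_{m_{ij}}\ (i\neq j)\rangle,$$ where $f_i\in\widehat{\mathbb{N}}_{\ge 2}$, $m_{ij}=m_{ji}\in\widehat{\mathbb{N}}_{\ge 2}$, and $m_{ij}\in\{2,\infty\}$ whenever $f_i\ge 3$ or $f_j\ge 3$; relations with $f_i=\infty$ or $m_{ij}=\infty$ are omitted. (The numbers $f_i,m_{ij}$ are determined by $(D,S)$.) **Dyer graph.** The Dyer graph associated with $(D,S)$ is $(\Gamma,f,m)$, where $\Gamma$ is the simple graph with vertices $v_1,\dots,v_n$,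 with $v_i,v_j$ ($i\ne j$) joined by an edge iff $m_{ij}\ge 3$, $f(v_i)=f_i$ is the vertex weight and $m(\{v_i,v_j\})=m_{ij}$ is the edge weight. **Order.** For Dyer systems $(D,S),(D',S')$ with Dyer graphs $(\Gamma,f,m),(\Gamma',f',m')$, write $(D,S)\preceq(D',S')$ if there is an injective map $\phi:V(\Gamma)\to V(\Gamma')$ such that for each edge $\{v,w\}\in E(\Gamma)$ one has $\{\phi(v),\phi(w)\}\in E(\Gamma')$ and $m(\{v,w\})\le m'(\{\phi(v),\phi(w)\})$, and $f(v)\le f'(\phi(v))$ for every $v\in V(\Gamma)$. *)

(* Defs.v *)
From HB Require Import structures.
From mathcomp Require Import all_boot all_order all_algebra finmap.
From mathcomp Require Import boolp classical_sets cardinality.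
From mathcomp Require Import reals topology normedtype sequences exp.

Set Implicit Arguments.
Unset Strict Implicit.
Unset Printing Implicit Defensive.

Import Order.TTheory GRing.Theory Num.Theory.
Import numFieldNormedType.Exports.

Local Open Scope classical_set_scope.

(* A finite generating set is given as a family [s : I -> G] over a finite type;
   the letter [(i, false)] stands for [s i] and [(i, true)] for its inverse. *)
Definition word (I : Type) := seq (I * bool).

Definition eval_letter (I : Type) (G : groupType) (s : I -> G)
    (l : I * bool) : G :=
  if l.2 then ((s l.1)^-1)%g else s l.1.

Definition eval_word (I : Type) (G : groupType) (s : I -> G) (w : word I) : G :=
  (\prod_(l <- w) eval_letter s l)%g.

Definition generates (I : Type) (G : groupType) (s : I -> G) : Prop :=
  forall x : G, exists w : word I, eval_word s w = x.

(* Equality in the group presented by the generators [I] and the relations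
   [u = v] for [r u v]. *)
Inductive presented_eq (I : Type) (r : word I -> word I -> Prop) :
    word I -> word I -> Prop :=
| presented_rel u v : r u v -> presented_eq r u v
| presented_cancel i b : presented_eq r [:: (i, b); (i, ~~ b)] [::]
| presented_refl u : presented_eq r u u
| presented_sym u v : presented_eq r u v -> presented_eq r v u
| presented_trans u v w :
    presented_eq r u v -> presented_eq r v w -> presented_eq r u w
| presented_cat u1 v1 u2 v2 :
    presented_eq r u1 v1 -> presented_eq r u2 v2 ->
    presented_eq r (u1 ++ u2) (v1 ++ v2).

(* The canonical map from the presented group to [G] is well defined and
   bijective. *)
Definition admits_presentation (I : Type) (G : groupType) (s : I -> G)
    (r : word I -> word I -> Prop) : Prop :=
  generates s /\
  forall u v : word I, eval_word s u = eval_word s v <-> presented_eq r u v.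

Section Growth.
Variables (I : finType) (G : groupType) (s : I -> G).

(* Elements outside the subgroup generated by [s] get the junk value 0; there
   are none when [generates s]. *)
Definition word_length (x : G) : nat :=
  match pselect (exists k : nat,
      `[< exists w : word I, size w = k /\ eval_word s w = x >]) with
  | left h => ex_minn h
  | right _ => 0
  end.

Definition sphere_growth (k : nat) : nat :=
  #|` fset_set [set x : G | word_length x = k]|%fset.

Definition ball_growth (k : nat) : nat :=
  #|` fset_set [set x : G | (word_length x <= k)%N]|%fset.

Definition growth_rate (R : realType) : R :=
  lim (((ball_growth k)%:R `^ (k%:R^-1) : R)%R @[k --> \oo]).

End Growth.

Variant natbar := Fin of nat | Infty.

Definition le_natbar (x y : natbar) : bool :=
  match x, y with
  | _, Infty => true
  | Infty, Fin _ => false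
  | Fin a, Fin b => (a <= b)%N
  end.

Definition alternating (I : Type) (i j : I) (k : nat) : word I :=
  mkseq (fun l => (if odd l then j else i, false)) k.

Inductive dyer_relation (I : Type) (f : I -> natbar) (m : I -> I -> natbar) :
    word I -> word I -> Prop :=
| dyer_power i k : f i = Fin k -> dyer_relation f m (nseq k (i, false)) [::]
| dyer_braid i j k : i <> j -> m i j = Fin k ->
    dyer_relation f m (alternating i j k) (alternating j i k).

(* The diagonal values of [m] are irrelevant. *)
Record dyer_system (n : nat) (D : groupType) (s : 'I_n -> D)
    (f : 'I_n -> natbar) (m : 'I_n -> 'I_n -> natbar) : Prop := DyerSystem {
  dyer_f_ge2 : forall i, le_natbar (Fin 2) (f i);
  dyer_m_sym : forall i j, i <> j -> m i j = m j i;
  dyer_m_ge2 : forall i j, i <> j -> le_natbar (Fin 2) (m i j);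
  dyer_m_2oo : forall i j, i <> j ->
    le_natbar (Fin 3) (f i) \/ le_natbar (Fin 3) (f j) ->
    m i j = Fin 2 \/ m i j = Infty;
  dyer_presentation : admits_presentation s (dyer_relation f m)
}.

Definition dyer_edge (n : nat) (m : 'I_n -> 'I_n -> natbar) (i j : 'I_n) : Prop :=
  i <> j /\ le_natbar (Fin 3) (m i j).

Definition dyer_le (n n' : nat)
    (f : 'I_n -> natbar) (m : 'I_n -> 'I_n -> natbar)
    (f' : 'I_n' -> natbar) (m' : 'I_n' -> 'I_n' -> natbar) : Prop :=
  exists phi : 'I_n -> 'I_n',
    [/\ injective phi,
        forall i j, dyer_edge m i j ->
          dyer_edge m' (phi i) (phi j) /\
          le_natbar (m i j) (m' (phi i) (phi j)) &
        forall i, le_natbar (f i) (f' (phi i))].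

(* Main.v *)
Require Import Defs.
From mathcomp Require Import all_boot all_order all_algebra algC cyclotomic finmap.
From mathcomp Require Import boolp classical_sets cardinality.
From mathcomp Require Import reals topology normedtype sequences exp.
From mathcomp Require Import zify ring lra.

(** A reduced expression in a Dyer group is a word in syllables [s_i^a]; Tits'
    theorem says that two reduced syllable words represent the same element iff
    they are related by braid moves. If [(D, S) <= (D', S')], then a braid move
    of [D'] on the image of a word reduced for [D] is already a braid move of
    [D]: a braid relation of [D'] longer than the one of [D] needs an alternating
    factor too long for a [D]-reduced word. Hence sending a reduced word to its
    image is a length-preserving injection of [D] into [D'], and Tits' theorem is
    only needed for [D'].

    For the Coxeter group [W] with the same [m], Tits' theorem holds because the
    parity of the number of times a word crosses a reflection is an invariant of
    the group element, which gives the exchange condition, and because a linear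
    representation in which [s_i s_j] has an eigenvalue of order exactly [m i j]
    shows that the rank-two subgroups do not collapse. The Dyer group acts on pairs
    made of an element of [W] and, for every generator of order at least 3, the list
    of exponents of its syllables; the orbit of the base point separates reduced
    words up to braid moves. The growth rates exist by Fekete's lemma. *)

Set Implicit Arguments.
Unset Strict Implicit.
Unset Printing Implicit Defensive.

Import Order.TTheory GRing.Theory Num.Theory.
Import numFieldNormedType.Exports.

(** * Rewriting words in context *)

Section Rewriting.
Variables (T : Type) (r : seq T -> seq T -> Prop).

Inductive rewrites : seq T -> seq T -> Prop :=
| rewrites_refl u : rewrites u u
| rewrites_step x l l' y v : r l l' ->
    rewrites (x ++ l' ++ y) v -> rewrites (x ++ l ++ y) v.

Lemma rewrites_trans v u w : rewrites u v -> rewrites v w -> rewrites u w.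
Proof.
elim=> [//|x l l' y v' rl _ IH] vw.
exact: (rewrites_step rl (IH vw)).
Qed.

Lemma rewrites_rel l l' : r l l' -> rewrites l l'.
Proof.
move=> rl; rewrite -[l]cats0 -[l' in rewrites _ l']cats0.
exact: (@rewrites_step [::] _ _ _ _ rl (rewrites_refl _)).
Qed.

Lemma rewrites_catl x u v : rewrites u v -> rewrites (x ++ u) (x ++ v).
Proof.
elim=> [u'|z l l' y v' rl _ IH]; first exact: rewrites_refl.
rewrite catA; apply: (rewrites_step rl); rewrite -catA; exact: IH.
Qed.

Lemma rewrites_catr y u v : rewrites u v -> rewrites (u ++ y) (v ++ y).
Proof.
elim=> [u'|x l l' z v' rl _ IH]; first exact: rewrites_refl.
rewrite -!catA; apply: (rewrites_step rl); move: IH; rewrite -!catA; exact: id.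
Qed.

Lemma rewrites_cat u u' v v' :
  rewrites u u' -> rewrites v v' -> rewrites (u ++ v) (u' ++ v').
Proof.
move=> uu' vv'; apply: (rewrites_trans (rewrites_catr _ uu')).
exact: rewrites_catl.
Qed.

Lemma rewrites_cons i u v : rewrites u v -> rewrites (i :: u) (i :: v).
Proof. exact: (@rewrites_catl [:: i]). Qed.

Lemma rewrites_sym : (forall l l', r l l' -> r l' l) ->
  forall u v, rewrites u v -> rewrites v u.
Proof.
move=> rsym u v; elim=> [u'|x l l' y v' rl _ IH]; first exact: rewrites_refl.
apply: (rewrites_trans IH); apply: (rewrites_step (rsym _ _ rl)).
exact: rewrites_refl.
Qed.

Lemma rewrites_invariant (X : Type) (F : seq T -> X) :
  (forall x l l' y, r l l' -> F (x ++ l ++ y) = F (x ++ l' ++ y)) ->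
  forall u v, rewrites u v -> F u = F v.
Proof. by move=> rF u v; elim=> [//|x l l' y v' rl _ <-]; apply: rF. Qed.

End Rewriting.

(** * Alternating words *)

Section Alternating.
Variable I : Type.
Implicit Types (i j : I).

Definition alt i j k : seq I := mkseq (fun l => if odd l then j else i) k.

Arguments alt : simpl never.

Lemma size_alt i j k : size (alt i j k) = k.
Proof. exact: size_mkseq. Qed.

Lemma altS i j k : alt i j k.+1 = i :: alt j i k.
Proof.
rewrite /alt /mkseq /= (iotaDl 1 0) -map_comp; congr (_ :: _).
by apply: eq_map => l /=; case: (odd l).
Qed.

Lemma alt_rcons i j k : alt i j k.+1 = rcons (alt i j k) (if odd k then j else i).
Proof. by rewrite /alt /mkseq -addn1 iotaD map_cat cats1. Qed.

Lemma rev_alt i j k : rev (alt i j k) = if odd k then alt i j k else alt j i k.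
Proof.
elim: k i j => [//|k IH] i j; rewrite {1}altS rev_cons IH /=.
by case: ifP => ok /=; rewrite alt_rcons ok.
Qed.

Lemma alt_cat i j k l :
  alt i j (k + l) = alt i j k ++ (if odd k then alt j i l else alt i j l).
Proof.
elim: k i j => [//|k IH] i j; rewrite addSn !altS IH /=.
by case: (odd k).
Qed.

(** Reversal inverts a word in involutions, so the braid relation of length [k] says $(ij)^k =
    1$. *)
Lemma alt_double i j k : alt i j k.*2 = alt i j k ++ rev (alt j i k).
Proof. by rewrite -addnn alt_cat rev_alt; case: (odd k). Qed.

Lemma map_alt (J : Type) (g : I -> J) i j k :
  map g (alt i j k) = mkseq (fun l => if odd l then g j else g i) k.
Proof.
by rewrite /alt /mkseq -map_comp; apply: eq_map => l /=; case: (odd l).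
Qed.

End Alternating.

(** * Tits' theorem for Coxeter groups *)

Section Coxeter.
Variables (I : eqType) (m : I -> I -> natbar).
Hypothesis m_sym : forall i j, i <> j -> m i j = m j i.

Implicit Types (i j : I) (u v w x y : seq I).

Inductive braid_rel : seq I -> seq I -> Prop :=
| Braid_rel i j k : i <> j -> m i j = Fin k -> braid_rel (alt i j k) (alt j i k).

(** Squares may be deleted and inserted, so [ceq] is symmetric and is equality in the Coxeter
    group. *)
Inductive coxeter_rel : seq I -> seq I -> Prop :=
| coxeter_sq i : coxeter_rel [:: i; i] [::]
| coxeter_sqV i : coxeter_rel [::] [:: i; i]
| coxeter_braid i j k : i <> j -> m i j = Fin k ->
    coxeter_rel (alt i j k) (alt j i k).

Local Notation ceq := (rewrites coxeter_rel).
Local Notation beq := (rewrites braid_rel).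

Lemma braid_rel_sym u v : braid_rel u v -> braid_rel v u.
Proof.
case=> i j k nij mij; apply: Braid_rel; first exact: nesym.
by rewrite -m_sym.
Qed.

Lemma coxeter_rel_sym u v : coxeter_rel u v -> coxeter_rel v u.
Proof.
case=> [i|i|i j k nij mij]; [exact: coxeter_sqV|exact: coxeter_sq|].
apply: coxeter_braid; first exact: nesym.
by rewrite -m_sym.
Qed.

Lemma braid_sym u v : beq u v -> beq v u.
Proof. exact/rewrites_sym/braid_rel_sym. Qed.

Lemma ceq_sym u v : ceq u v -> ceq v u.
Proof. exact/rewrites_sym/coxeter_rel_sym. Qed.

Lemma ceq_trans v u w : ceq u v -> ceq v w -> ceq u w.
Proof. exact: rewrites_trans. Qed.

Lemma ceq_refl u : ceq u u.
Proof. exact: rewrites_refl. Qed.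

Lemma ceq_sq i u : ceq (i :: i :: u) u.
Proof. exact: (rewrites_catr u (rewrites_rel (coxeter_sq i))). Qed.

Lemma ceq_revV u : ceq (u ++ rev u) [::].
Proof.
elim: u => [|i u IH]; first exact: ceq_refl.
rewrite rev_cons -cats1 /= catA.
apply: ceq_trans (ceq_sq i [::]); apply: rewrites_cons.
exact: (@rewrites_catr _ _ [:: i] _ _ IH).
Qed.

Lemma ceq_Vrev u : ceq (rev u ++ u) [::].
Proof. by have := ceq_revV (rev u); rewrite revK. Qed.

Lemma ceq_Krev u v : ceq (rev u ++ u ++ v) v.
Proof. by rewrite catA; apply: (rewrites_catr v (ceq_Vrev u)). Qed.

Lemma ceq_catI u v w : ceq (u ++ v) (u ++ w) -> ceq v w.
Proof.
move=> /(rewrites_catl (rev u)) h.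
apply: ceq_trans (ceq_Krev u w); apply: ceq_trans h.
exact/ceq_sym/ceq_Krev.
Qed.

Lemma ceq_cat_move u v w : ceq (u ++ v) w -> ceq v (rev u ++ w).
Proof.
move=> /(rewrites_catl (rev u)); apply: ceq_trans; exact/ceq_sym/ceq_Krev.
Qed.

Lemma ceq_catr_move u v w : ceq (v ++ u) w -> ceq v (w ++ rev u).
Proof.
move=> /(rewrites_catr (rev u)); apply: ceq_trans.
rewrite -catA -[X in ceq X]cats0; apply: rewrites_catl; exact/ceq_sym/ceq_revV.
Qed.

Lemma ceq_rev u v : ceq u v -> ceq (rev u) (rev v).
Proof.
move=> uv; have := ceq_revV v => /ceq_cat_move; rewrite cats0; apply: ceq_trans.
rewrite -[rev u]cats0; apply: ceq_sym; apply: ceq_cat_move.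
exact: ceq_trans (rewrites_catr _ uv) (ceq_revV v).
Qed.

(** * Conjugates and wall crossings *)

Definition conj_word u x := u ++ x ++ rev u.

Lemma conj_word_ceq u x y : ceq x y -> ceq (conj_word u x) (conj_word u y).
Proof. by move=> xy; apply/rewrites_catl/rewrites_catr. Qed.

Lemma conj_word_ceql u v x : ceq u v -> ceq (conj_word u x) (conj_word v x).
Proof.
by move=> uv; apply: rewrites_cat => //; apply/rewrites_catl/ceq_rev.
Qed.

Lemma conj_wordK u x : ceq (conj_word (rev u) (conj_word u x)) x.
Proof.
rewrite /conj_word revK -!catA; apply: ceq_trans (ceq_Krev u _) _.
rewrite -[X in ceq _ X]cats0; apply/rewrites_catl/ceq_Vrev.
Qed.

Lemma conj_word_move u x y :
  ceq x (conj_word u y) <-> ceq (conj_word (rev u) x) y.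
Proof.
split=> h.
  exact: ceq_trans (conj_word_ceq (rev u) h) (conj_wordK u y).
apply: ceq_trans (conj_word_ceq u h); apply: ceq_sym.
by have := conj_wordK (rev u) x; rewrite revK.
Qed.

(* The words [w1 ++ i :: rev w1] over all factorizations [w = w1 ++ i :: w2]:
   the reflections that separate the identity from the element of [w]. *)
Fixpoint walls w : seq (seq I) :=
  if w is i :: w' then [:: i] :: map (conj_word [:: i]) (walls w') else [::].

Definition crossings w x := count (fun y => `[< ceq x y >]) (walls w).

Definition parity w x := odd (crossings w x).

Lemma ceq_asbool x x' y : ceq x x' -> `[< ceq x y >] = `[< ceq x' y >].
Proof.
move=> xx'; apply/asboolP/asboolP; apply: ceq_trans => //; exact: ceq_sym.
Qed.

Lemma crossings_ceq w x y : ceq x y -> crossings w x = crossings w y.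
Proof. by move=> xy; apply: eq_count => z; apply: ceq_asbool. Qed.

Lemma crossings_map u (W : seq (seq I)) x :
  count (fun y => `[< ceq x y >]) (map (conj_word u) W) =
  count (fun y => `[< ceq (conj_word (rev u) x) y >]) W.
Proof.
rewrite count_map; apply: eq_count => y /=.
by apply/asboolP/asboolP => /conj_word_move.
Qed.

Lemma crossings_cons i w x :
  crossings (i :: w) x = `[< ceq x [:: i] >] + crossings w (conj_word [:: i] x).
Proof. by rewrite /crossings /= crossings_map. Qed.

(** Counting crossings is a cocycle, which reduces the invariance of parity to single relations. *)
Lemma crossings_cat u v x :
  crossings (u ++ v) x = crossings u x + crossings v (conj_word (rev u) x).
Proof.
elim: u x => [|i u IH] x; first by rewrite /conj_word /= cats0.
rewrite cat_cons !crossings_cons IH addnA; congr (_ + crossings _ _).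
by rewrite /conj_word !revK !rev_cons -!cats1 -!catA.
Qed.

Lemma walls_alt i j k :
  walls (alt i j k) = mkseq (fun l => alt i j l.*2.+1) k.
Proof.
elim: k i j => [//|k IH] i j.
rewrite altS /= IH /mkseq /= (iotaDl 1 0) -!map_comp; congr (_ :: _).
apply: eq_map => l; rewrite /= doubleS [alt i j _.+3]altS !alt_rcons /=.
by rewrite odd_double /conj_word cats1.
Qed.

Lemma conj_alt i j k :
  conj_word (alt i j k) [:: if odd k then j else i] = alt i j k.*2.+1.
Proof.
rewrite /conj_word catA cats1 -alt_rcons -addnn -addSn alt_cat rev_alt /=.
by case: (odd k).
Qed.

(** The first word followed by the second spells $(ij)^k = 1$, and an alternating word of odd length
    is its own inverse. *)
Lemma alt_odd_swap i j k l : i <> j -> m i j = Fin k -> l < k ->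
  ceq (alt i j l.*2.+1) (alt j i (k - l.+1).*2.+1).
Proof.
move=> nij mij lk.
have double_nil : ceq (alt i j k.*2) [::].
  rewrite alt_double; apply: ceq_trans (ceq_revV (alt j i k)).
  exact/rewrites_catr/rewrites_rel/coxeter_braid.
rewrite -[X in ceq _ X]revK rev_alt /= odd_double /=.
apply: (@ceq_catr_move _ _ [::]).
suff -> : alt i j l.*2.+1 ++ alt j i (k - l.+1).*2.+1 = alt i j k.*2 by [].
have -> : k.*2 = l.*2.+1 + (k - l.+1).*2.+1 by lia.
by rewrite alt_cat /= odd_double.
Qed.

Lemma crossings_braid i j k x : i <> j -> m i j = Fin k ->
  crossings (alt i j k) x = crossings (alt j i k) x.
Proof.
move=> nij mij; rewrite /crossings !walls_alt /mkseq !count_map.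
rewrite -!sum1_count -[k in iota _ k]subn0 -/(index_iota 0 k) big_mkcond.
(* The two sides of a braid relation cross the same reflections in opposite orders, so one sum is
   reversed. *)
rewrite [RHS]big_mkcond [RHS]big_nat_rev; apply: eq_big_nat => l /= lk.
rewrite add0n; congr (if _ then _ else _).
have e := alt_odd_swap nij mij lk.
apply/asboolP/asboolP => h; apply: (ceq_trans h) => //; exact: ceq_sym.
Qed.

Lemma parity_cat u v x :
  parity (u ++ v) x = parity u x (+) parity v (conj_word (rev u) x).
Proof. by rewrite /parity crossings_cat oddD. Qed.

Lemma parity_cons i w x :
  parity (i :: w) x = `[< ceq x [:: i] >] (+) parity w (conj_word [:: i] x).
Proof. by rewrite /parity crossings_cons oddD oddb. Qed.

Lemma parity_ceqr w x y : ceq x y -> parity w x = parity w y.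
Proof. by rewrite /parity => /crossings_ceq ->. Qed.

(** Cancelling [ii] removes two crossings of one wall, which is why only the parity survives; a
    braid move preserves even the count. *)
Lemma parity_rel l l' x : coxeter_rel l l' -> parity l x = parity l' x.
Proof.
have sq i : parity [:: i; i] x = false.
  rewrite !parity_cons addbF.
  suff -> : `[< ceq x [:: i] >] = `[< ceq (conj_word [:: i] x) [:: i] >].
    exact: addbb.
  have e : ceq (conj_word [:: i] [:: i]) [:: i] by apply: ceq_sq.
  apply/asboolP/asboolP => h; first exact: ceq_trans (conj_word_ceq _ h) e.
  apply: (ceq_trans _ e); exact/conj_word_move.
case=> [i|i|i j k nij mij]; rewrite ?sq //.
by rewrite /parity (crossings_braid _ nij mij).
Qed.

Lemma parity_ceq u v x : ceq u v -> parity u x = parity v x.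
Proof.
apply: (@rewrites_invariant _ _ _ (parity^~ x)) => y l l' z rl.
rewrite !parity_cat (parity_rel _ rl); congr (_ (+) (_ (+) _)).
by apply/parity_ceqr/conj_word_ceql/ceq_rev/rewrites_rel.
Qed.

Lemma parity_split w x : parity w x ->
  exists w1 i w2, w = w1 ++ i :: w2 /\ ceq x (conj_word w1 [:: i]).
Proof.
elim: w x => [//|i w IH] x; rewrite parity_cons.
case: asboolP => /= [xi _|_ /IH [w1 [j [w2 [-> h]]]]].
  by exists [::], i, w.
exists (i :: w1), j, w2; split => //.
have := proj2 (conj_word_move [:: i] _ _) h.
by rewrite /conj_word !rev_cons -!cats1 /= -!catA.
Qed.

Lemma exchange_at i w1 j w2 : ceq [:: i] (conj_word w1 [:: j]) ->
  ceq (w1 ++ j :: w2) (i :: w1 ++ w2).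
Proof.
move=> h; apply: ceq_sym; rewrite -cat1s.
apply: ceq_trans (rewrites_catr (w1 ++ w2) h) _.
rewrite /conj_word -!catA; apply/rewrites_catl/rewrites_catl/ceq_Krev.
Qed.

(** An odd number of crossings is nonzero, so some letter of [w] crosses the wall of [i]; it can be
    deleted in return for an [i] in front. *)
Lemma exchange i w : parity w [:: i] ->
  exists w', ceq w (i :: w') /\ size w = (size w').+1.
Proof.
move=> /parity_split [w1 [j [w2 [-> /exchange_at h]]]].
by exists (w1 ++ w2); split => //; rewrite !size_cat /= addnS.
Qed.

Definition minimal w := forall v, ceq w v -> size w <= size v.

Lemma minimal_ceq u v : minimal u -> ceq u v -> size v = size u -> minimal v.
Proof. by move=> mu uv suv w vw; rewrite suv; apply: mu; apply: ceq_trans vw. Qed.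

Lemma minimal_behead i w : minimal (i :: w) -> minimal w.
Proof. by move=> mw v /(rewrites_cons i) /mw. Qed.

Lemma minimal_parity_behead i w : minimal (i :: w) -> parity w [:: i] = false.
Proof.
move=> mw; apply/negP => /exchange [w' [/(rewrites_cons i) ww' sw]].
by have := mw w' (ceq_trans ww' (ceq_sq i w')); rewrite /= sw; lia.
Qed.

Lemma parity_head i w : parity (i :: w) [:: i] = ~~ parity w [:: i].
Proof.
rewrite parity_cons asboolT; last exact: ceq_refl.
by congr (~~ _); apply/parity_ceqr/ceq_sq.
Qed.

Lemma minimal_parity i w : minimal (i :: w) -> parity (i :: w) [:: i].
Proof. by move=> mw; rewrite parity_head minimal_parity_behead. Qed.

Lemma ex_minimal w : exists2 v, ceq w v & minimal v.
Proof.
have [k] := ubnP (size w); elim: k w => // k IH w wk.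
have [mw|] := pselect (minimal w); first by exists w => //; apply: ceq_refl.
move=> /existsNP [v /not_implyP [wv /negP]]; rewrite -ltnNge => vw.
have [v' vv' mv'] := IH v (leq_trans vw wk).
by exists v' => //; apply: ceq_trans vv'.
Qed.

(** * Tits' theorem from exact rank-two orders *)

Hypothesis m_ge2 : forall i j, i <> j -> le_natbar (Fin 2) (m i j).

(** For infinite [m i j] the condition on [l] is vacuous, so no positive power of $ij$ is trivial.
    The linear representation below supplies this. *)
Hypothesis order_exact : forall i j k, i <> j -> 0 < k ->
  (forall l, m i j = Fin l -> k < l) -> ~ ceq (alt i j k.*2) [::].

(** Induction on [k] with [i] and [j] swapped: the exchange for [i] is applied to a word starting
    with [alt j i k], and the deleted letter cannot lie in this prefix. *)
Lemma alternating_prefix i j w k : i <> j -> minimal w ->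
  parity w [:: i] -> parity w [:: j] ->
  (forall l, m i j = Fin l -> k <= l) ->
  exists z, ceq w (alt i j k ++ z) /\ size w = k + size z.
Proof.
elim: k i j => [|k IH] i j nij mw wi wj mk.
  by exists w; split => //; apply: ceq_refl.
have [|z [wz sz]] := IH j i (nesym nij) mw wj wi.
  by move=> l; rewrite -m_sym // => /mk /ltnW.
move: wi; rewrite (parity_ceq _ wz) => /parity_split [w1 [c [w2 [e h]]]].
have [kw1|w1k] := leqP k (size w1).
  have ew1 : w1 = alt j i k ++ drop k w1.
    have := congr1 (take k) e.
    by rewrite take_size_cat ?size_alt // takel_cat // => ->; rewrite cat_take_drop.
  exists (drop k w1 ++ w2); split.
    rewrite altS cat_cons catA -ew1; apply: (ceq_trans wz); rewrite e.
    exact: exchange_at.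
  by have := congr1 size e; rewrite !size_cat size_alt size_drop /=; lia.
(* With [p = size w1], a deletion inside the prefix would give $(ij)^{p+1} = 1$, although $p + 1 \le
   k$ lies below [m i j]. *)
exfalso; apply: (order_exact (i := i) (j := j) (k := (size w1).+1)) => //.
  by move=> l /mk; lia.
have ew1 : w1 = alt j i (size w1).
  have := congr1 (take (size w1)) e.
  rewrite [RHS]take_size_cat // takel_cat ?size_alt 1?ltnW // => e1; rewrite -[LHS]e1.
  by rewrite -[in LHS](subnKC (ltnW w1k)) alt_cat take_size_cat ?size_alt.
have ec : c = if odd (size w1) then i else j.
  have := congr1 (fun s => nth c s (size w1)) e.
  rewrite nth_cat size_alt w1k nth_cat ltnn subnn /= => <-.
  by rewrite /alt nth_mkseq.
rewrite doubleS altS -conj_alt -ew1 -ec.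
exact: ceq_trans (rewrites_cons i (ceq_sym h)) (ceq_sq i [::]).
Qed.

(** Induction on the length. If the first letters [i] and [j] differ, both are descents, so the
    element has minimal words starting with [alt i j] and [alt j i] of length [m i j]. One braid
    move joins these two, and each shares its first letter with [u] or [v]. *)
Theorem minimal_braid u v : minimal u -> ceq u v -> size v = size u -> beq u v.
Proof.
have [k] := ubnP (size u).
elim: k u v => [//|k IH] [|i u] [|j v] // uk mu uv suv.
  exact: rewrites_refl.
case: suv => suv; rewrite /= in uk.
have mv : minimal (j :: v) by apply: (minimal_ceq mu uv); rewrite /= suv.
have same_head h y z : minimal (h :: y) -> size y = size u ->
    size z = size y -> ceq (h :: y) (h :: z) -> beq (h :: y) (h :: z).
  move=> my sy sz /(@ceq_catI [:: h]) yz; apply: rewrites_cons.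
  by apply: IH => //; [lia|apply: minimal_behead my].
have [eij|/eqP nij] := eqVneq i j.
  by rewrite -eij in uv *; apply: same_head.
have ui : parity (i :: u) [:: i] by apply: minimal_parity.
have uj : parity (i :: u) [:: j] by rewrite (parity_ceq _ uv) minimal_parity.
case mij : (m i j) => [l|].
  have [l' ml'|z [uz sz]] := @alternating_prefix i j (i :: u) l nij mu ui uj.
    by move: ml'; rewrite mij => -[->].
  case: l mij uz sz => [|l] mij uz sz.
    by have := m_ge2 nij; rewrite mij.
  apply: (@rewrites_trans _ _ (alt i j l.+1 ++ z)).
    move: uz; rewrite altS => uz; apply: same_head => //.
    by rewrite size_cat size_alt; move: sz => /=; lia.
  have szv : size v = size (alt i j l ++ z).
    by rewrite size_cat size_alt suv; move: sz => /=; lia.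
  apply: (@rewrites_trans _ _ (alt j i l.+1 ++ z)).
    exact/rewrites_catr/rewrites_rel/Braid_rel.
  apply: braid_sym; rewrite altS; apply: same_head => //.
  apply: ceq_trans (ceq_sym uv) _; apply: ceq_trans uz _; rewrite -cat_cons -altS.
  exact/rewrites_catr/rewrites_rel/coxeter_braid.
(* If [m i j] were infinite, an alternating prefix longer than the word itself would exist. *)
have [|z [_ /=]] := @alternating_prefix i j (i :: u) (size u).+2 nij mu ui uj.
  by rewrite mij.
lia.
Qed.

Definition braid_reduced w :=
  forall v, beq w v -> forall x i y, v <> x ++ [:: i; i] ++ y.

(** If [i] were a descent of the minimal word [u], braid moves would bring [u] to the form [i :: u']
    and expose a square in [i :: u]. *)
Theorem braid_reduced_minimal w : braid_reduced w -> minimal w.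
Proof.
elim: w => [//|i u IH] rw.
have mu : minimal u.
  apply: IH => v uv x j y ev; apply: (rw (i :: v) _ (i :: x) j y).
    exact: rewrites_cons.
  by rewrite ev.
case pu : (parity u [:: i]).
  have [u' [uu' su]] := exchange pu.
  have bu : beq u (i :: u') by apply: minimal_braid.
  by have := rw _ (rewrites_cons i bu) [::] i u'.
(* Now [i] is a descent of [i :: u], so exchange puts [i] in front of a minimal word [v]; what
   follows represents [u] and is no shorter than [u]. *)
move=> v0 iuv0.
have [v iuv mv] := ex_minimal v0.
have pv : parity v [:: i].
  by rewrite -(parity_ceq _ iuv) -(parity_ceq _ iuv0) parity_head pu.
have [v' [vv' sv]] := exchange pv.
have : size v <= size v0 by apply: mv; apply: ceq_sym.
rewrite sv /=; apply: leq_trans; rewrite ltnS; apply: mu.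
apply: (@ceq_catI [:: i]); apply: ceq_trans vv'; exact: ceq_trans iuv.
Qed.

Theorem braid_reduced_ceq u v :
  braid_reduced u -> braid_reduced v -> ceq u v -> beq u v.
Proof.
move=> /braid_reduced_minimal mu /braid_reduced_minimal mv uv.
apply: minimal_braid => //; apply/eqP; rewrite eqn_leq mu // mv //.
exact: ceq_sym.
Qed.

End Coxeter.

(** * A representation with exact rank-two orders *)

Section Representation.
Local Open Scope ring_scope.
Variables (n : nat) (m : 'I_n -> 'I_n -> natbar).
Hypothesis m_sym : forall i j, i <> j -> m i j = m j i.
Hypothesis m_ge2 : forall i j, i <> j -> le_natbar (Fin 2) (m i j).

Implicit Types (i j : 'I_n) (v : 'cV[algC]_n).

(* For [m = Infty] any number that is not a root of unity works. *)
Definition weight_root (x : natbar) : algC :=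
  match x with
  | Fin k.+1 => sval (C_prim_root_exists (ltn0Sn k))
  | Fin 0 => 1
  | Infty => 2
  end.

Lemma weight_root_exp (x : natbar) k : le_natbar (Fin 2) x ->
  (weight_root x ^+ k == 1) =
  match x with Fin l => (l %| k)%N | Infty => k == 0%N end.
Proof.
case: x => [[//|l]|] _ /=.
  by case: C_prim_root_exists => z zP /=; rewrite -(prim_order_dvd zP).
by case: k => [|k]; rewrite ?expr0 ?eqxx // -natrX pnatr_eq1 expnS; lia.
Qed.

Lemma weight_root_neq0 (x : natbar) : weight_root x != 0.
Proof.
case: x => [[|k]|] /=; rewrite ?oner_eq0 ?pnatr_eq0 //.
by case: C_prim_root_exists => z zP /=; rewrite (prim_root_eq0 zP).
Qed.

(** Comparing indices orients each pair, so that the roots of [(i, j)] and [(j, i)] are mutually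
    inverse. *)
Definition pair_root i j : algC :=
  if (i < j)%N then weight_root (m i j) else (weight_root (m i j))^-1.

Lemma pair_rootC i j : i <> j -> pair_root j i = (pair_root i j)^-1.
Proof.
move=> nij; rewrite /pair_root -(m_sym nij).
have : (i != j :> nat) by apply/eqP => /val_inj.
by case: ltngtP => //= _ _; rewrite ?invrK.
Qed.

Lemma pair_root_neq0 i j : pair_root i j != 0.
Proof. by rewrite /pair_root; case: ifP; rewrite ?invr_eq0 weight_root_neq0. Qed.

Lemma pair_root_exp i j k : i <> j ->
  (pair_root i j ^+ k == 1) =
  match m i j with Fin l => (l %| k)%N | Infty => k == 0%N end.
Proof.
move=> nij; rewrite -weight_root_exp; last exact: m_ge2.
rewrite /pair_root; case: ifP => // _.
by rewrite exprVn invr_eq1.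
Qed.

Lemma pair_root_neq1 i j : i <> j -> pair_root i j != 1.
Proof.
move=> nij; rewrite -[pair_root i j]expr1 pair_root_exp //.
by have := m_ge2 nij; case: (m i j) => [l|] //=; rewrite dvdn1; lia.
Qed.

(** A generalized Cartan matrix with $c_{ij} c_{ji} = 2 + z + z^{-1}$, where [z] is the root of the
    pair; the product of the two reflections then has eigenvalues $z$ and $z^{-1}$ on the plane of
    [i] and [j]. *)
Definition cartan i j : algC := if i == j then 2 else - (1 + pair_root i j).

Definition basis i : 'cV[algC]_n := delta_mx i 0.

Definition coroot i v : algC := \sum_j cartan i j * v j 0.

Definition reflection i v := v - coroot i v *: basis i.

Lemma corootD i v w : coroot i (v + w) = coroot i v + coroot i w.
Proof.
by rewrite /coroot -big_split; apply: eq_bigr => j _; rewrite mxE mulrDr.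
Qed.

Lemma corootZ i c v : coroot i (c *: v) = c * coroot i v.
Proof.
by rewrite /coroot big_distrr; apply: eq_bigr => j _; rewrite mxE mulrCA.
Qed.

Lemma coroot_basis i j : coroot i (basis j) = cartan i j.
Proof.
rewrite /coroot (bigD1 j) //= big1 => [|l /negPf lj]; rewrite mxE ?eqxx ?lj /=.
  by rewrite mulr1 addr0.
by rewrite mulr0.
Qed.

Lemma reflectionD i v w : reflection i (v + w) = reflection i v + reflection i w.
Proof. by rewrite /reflection corootD scalerDl opprD addrACA. Qed.

Lemma reflectionZ i c v : reflection i (c *: v) = c *: reflection i v.
Proof. by rewrite /reflection corootZ -scalerA -scalerBr. Qed.

Lemma reflectionK i v : reflection i (reflection i v) = v.
Proof.
rewrite /reflection -scaleN1r corootD corootZ corootZ coroot_basis /cartan eqxx.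
rewrite scaleN1r -addrA -opprD -scalerDl.
have -> : coroot i v + (coroot i v + -1 * (coroot i v * 2)) = 0 by ring.
by rewrite scale0r subr0.
Qed.

Definition reflections (w : seq 'I_n) v := foldr reflection v w.

Lemma reflections_cat u w v : reflections (u ++ w) v = reflections u (reflections w v).
Proof. exact: foldr_cat. Qed.

Definition rotation i j v := reflection i (reflection j v).

Lemma reflections_alt i j k v :
  reflections (alt i j k.*2) v = iter k (rotation i j) v.
Proof. by elim: k => [//|k IH]; rewrite doubleS !altS /= IH. Qed.

Lemma iter_rotationD i j k v w : iter k (rotation i j) (v + w) =
  iter k (rotation i j) v + iter k (rotation i j) w.
Proof. by elim: k => //= k ->; rewrite /rotation !reflectionD. Qed.

Lemma iter_rotation_eigen i j k (c : algC) v : rotation i j v = c *: v ->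
  iter k (rotation i j) v = c ^+ k *: v.
Proof.
move=> e; elim: k => [|k IH] /=; first by rewrite expr0 scale1r.
by rewrite IH /rotation !reflectionZ -/(rotation i j v) e scalerA exprSr.
Qed.

Definition eigen1 i j := basis i + basis j.
Definition eigen2 i j := pair_root i j *: basis i + basis j.

Lemma rotation_eigen1 i j : i <> j ->
  rotation i j (eigen1 i j) = (pair_root i j)^-1 *: eigen1 i j.
Proof.
move=> nij; have z0 := pair_root_neq0 i j.
rewrite /rotation /reflection /eigen1 -!scaleN1r !(corootD, corootZ, coroot_basis).
rewrite /cartan !eqxx [j == i]eq_sym (introF eqP nij) (pair_rootC nij).
set z := pair_root i j in z0 *.
apply/matrixP => k l; rewrite !mxE.
by field.
Qed.

Lemma rotation_eigen2 i j : i <> j ->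
  rotation i j (eigen2 i j) = pair_root i j *: eigen2 i j.
Proof.
move=> nij; have z0 := pair_root_neq0 i j.
rewrite /rotation /reflection /eigen2 -!scaleN1r !(corootD, corootZ, coroot_basis).
rewrite /cartan !eqxx [j == i]eq_sym (introF eqP nij) (pair_rootC nij).
set z := pair_root i j in z0 *.
apply/matrixP => k l; rewrite !mxE.
by field.
Qed.

Lemma rotation_fix i j v : coroot i v = 0 -> coroot j v = 0 -> rotation i j v = v.
Proof.
by move=> vi vj; rewrite /rotation /reflection vj scale0r subr0 vi scale0r subr0.
Qed.

(** As $z \ne 1$, the two coroots are independent on the plane of the eigenvectors, so their common
    kernel complements it. *)
Lemma rotation_decomposition i j v : i <> j -> exists a b u,
  [/\ v = a *: eigen1 i j + b *: eigen2 i j + u, coroot i u = 0 & coroot j u = 0].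
Proof.
move=> nij; have z0 := pair_root_neq0 i j; have z1 := pair_root_neq1 nij.
set z := pair_root i j in z0 z1.
have z1' : 1 - z != 0 by rewrite subr_eq0 eq_sym.
(* With $c_i, c_j$ the coroot values of [v], these solve $(1-z)(a-b) = c_i$ and $(1-z^{-1})a +
   (1-z)b = c_j$. *)
pose a := - z * (coroot i v + coroot j v) / (1 - z) ^+ 2.
pose b := a - coroot i v / (1 - z).
exists a, b, (v - (a *: eigen1 i j + b *: eigen2 i j)); split.
- by rewrite addrC subrK.
- rewrite /eigen1 /eigen2 -!scaleN1r !(corootD, corootZ, coroot_basis).
  rewrite /cartan !eqxx (introF eqP nij) -/z /b /a.
  by field.
- rewrite /eigen1 /eigen2 -!scaleN1r !(corootD, corootZ, coroot_basis).
  rewrite /cartan !eqxx [j == i]eq_sym (introF eqP nij) (pair_rootC nij) -/z /b /a.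
  by field; rewrite z0.
Qed.

(** The rotation is diagonal on the decomposition, with eigenvalues $z^{-1}$, $z$ and $1$, and $z^k
    = 1$. *)
Lemma rotation_order i j k v : i <> j -> m i j = Fin k ->
  iter k (rotation i j) v = v.
Proof.
move=> nij mij; have [a [b [u [-> ui uj]]]] := rotation_decomposition v nij.
have zk : pair_root i j ^+ k = 1 by apply/eqP; rewrite pair_root_exp // mij.
rewrite !iter_rotationD !(@iter_rotation_eigen _ _ _ 1 u) ?scale1r ?expr1n ?scale1r;
  last by rewrite rotation_fix.
rewrite (@iter_rotation_eigen _ _ _ (pair_root i j)^-1); last first.
  by rewrite /rotation !reflectionZ -/(rotation i j _) rotation_eigen1 // !scalerA mulrC.
rewrite (@iter_rotation_eigen _ _ _ (pair_root i j)); last first.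
  by rewrite /rotation !reflectionZ -/(rotation i j _) rotation_eigen2 // !scalerA mulrC.
by rewrite exprVn zk invr1 !scale1r.
Qed.

Lemma reflections_rev w v : reflections (rev w) (reflections w v) = v.
Proof.
elim: w v => [//|i w IH] v.
by rewrite rev_cons -cats1 reflections_cat /= reflectionK IH.
Qed.

Lemma reflections_ceq u w : rewrites (coxeter_rel m) u w ->
  reflections u = reflections w.
Proof.
apply: rewrites_invariant => x l l' y rl; apply/funext => v.
rewrite !reflections_cat; congr (reflections x _).
move: (reflections y v) => {}v {x y}.
case: rl => [i|i|i j k nij mij] /=; rewrite ?reflectionK //.
(* Once $(s_i s_j)^k = 1$ is inserted on the right-hand side, its reversed half cancels. *)
rewrite -[RHS](rotation_order _ nij mij) -reflections_alt alt_double reflections_cat.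
by rewrite reflections_rev.
Qed.

Lemma coxeter_order_exact i j k : i <> j -> (0 < k)%N ->
  (forall l, m i j = Fin l -> (k < l)%N) ->
  ~ rewrites (coxeter_rel m) (alt i j k.*2) [::].
Proof.
move=> nij k0 kl /reflections_ceq /(congr1 (fun h => h (eigen2 i j))) /=.
rewrite reflections_alt (iter_rotation_eigen _ (rotation_eigen2 nij)).
(* The [j]-coordinate of [eigen2] is 1, so this entry reads $z^k = 1$. *)
move=> /matrixP /(_ j 0); rewrite !mxE [j == i]eq_sym (introF eqP nij) /=.
rewrite eqxx mulr0 add0r mulr1 => /eqP; rewrite pair_root_exp //.
case e : (m i j) => [l|]; last by case: k k0 {kl}.
by move=> /(dvdn_leq k0); rewrite leqNgt kl.
Qed.

End Representation.

(** * The action of a Dyer group *)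

Definition norm_exp (x : natbar) (a : int) : int :=
  if x is Fin k then (a %% k%:Z)%Z else a.

(** Nonzero representatives modulo [k] of smallest absolute value, a tie at $k/2$ going to the
    positive one. While [norm_exp] only labels the residue, these count letters. *)
Definition balanced (x : natbar) (a : int) : bool :=
  (a != 0) && if x is Fin k then (- k%:Z < a + a <= k%:Z)%R else true.

Lemma norm_exp0 x : norm_exp x 0 = 0.
Proof. by case: x => [k|] //=; rewrite mod0z. Qed.

Lemma norm_exp_addl x a b : norm_exp x (norm_exp x a + b) = norm_exp x (a + b).
Proof. by case: x => [k|] //=; rewrite modzDml. Qed.

Lemma norm_expK x a : norm_exp x (norm_exp x a) = norm_exp x a.
Proof. by case: x => [k|] //=; rewrite modz_mod. Qed.

Lemma norm_exp_addk k a : norm_exp (Fin k) (a + k%:Z) = norm_exp (Fin k) a.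
Proof. by rewrite /= modzDr. Qed.

Lemma norm_exp_small x : le_natbar (Fin 3) x -> norm_exp x 1 = 1.
Proof. by case: x => [k|] //= k3; rewrite modz_small; lia. Qed.

Lemma balanced_norm_neq0 x a : balanced x a -> norm_exp x a != 0.
Proof.
case: x => [k|] /=; last by case/andP.
case/andP=> a0 /andP [lo hi]; apply/negP => /eqP /dvdz_mod0P /dvdzP [q aq].
rewrite {}aq in a0 lo hi.
have [q0|q0|q0] := ltrgtP q 0%R; last by rewrite q0 mul0r in a0.
- nia.
- nia.
Qed.

Lemma balanced_norm_inj x a b :
  balanced x a -> balanced x b -> norm_exp x a = norm_exp x b -> a = b.
Proof.
case: x => [k|] //= /andP [_ /andP [alo ahi]] /andP [_ /andP [blo bhi]] /eqP.
rewrite eqz_mod_dvd => /dvdzP [q abq].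
have q0 : q = 0 by nia.
by move: abq; rewrite q0 mul0r => /eqP; rewrite subr_eq0 => /eqP.
Qed.

(** With streams instead of finite lists there is always a top exponent to remove, so a move is
    defined on every state. *)
Definition streamcons (a : int) (s : nat -> int) (l : nat) : int :=
  if l is l'.+1 then s l' else a.

Section Action.
Variables (I : eqType) (f : I -> natbar) (m : I -> I -> natbar).
Hypothesis f_ge2 : forall i, le_natbar (Fin 2) (f i).
Hypothesis m_sym : forall i j, i <> j -> m i j = m j i.
Hypothesis m_ge2 : forall i j, i <> j -> le_natbar (Fin 2) (m i j).
Hypothesis m_2oo : forall i j, i <> j ->
  le_natbar (Fin 3) (f i) \/ le_natbar (Fin 3) (f j) ->
  m i j = Fin 2 \/ m i j = Infty.
Hypothesis order_exact : forall i j k, i <> j -> 0 < k ->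
  (forall l, m i j = Fin l -> k < l) ->
  ~ rewrites (coxeter_rel m) (alt i j k.*2) [::].

Implicit Types (i j : I) (w : seq I) (e a : int) (s : nat -> int).

Local Notation ceq := (rewrites (coxeter_rel m)).

Definition thick i := le_natbar (Fin 3) (f i).

Arguments thick : simpl never.

Lemma thinE i : thick i = false -> f i = Fin 2.
Proof.
rewrite /thick; have := f_ge2 i; case: (f i) => [k|] //=.
by rewrite ltnNge => k2 k3; congr Fin; lia.
Qed.

Definition descent w i := parity m w [:: i].

Lemma descent_cons i w : descent (i :: w) i = ~~ descent w i.
Proof. exact: parity_head. Qed.

Lemma descent_ceq w w' i : ceq w w' -> descent w i = descent w' i.
Proof. exact: parity_ceq. Qed.

(** Conjugation by [j] fixes the reflection [i], and [i] and [j] are distinct reflections because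
    $ij \ne 1$. *)
Lemma descent_commute i j w : i <> j -> m i j = Fin 2 ->
  descent (j :: w) i = descent w i.
Proof.
move=> nij mij; rewrite /descent parity_cons // asboolF /=.
  apply: parity_ceqr => //.
  have swap : ceq ([:: j; i] ++ [:: j]) ([:: i; j] ++ [:: j]).
    apply: rewrites_catr; apply/rewrites_rel.
    apply: (coxeter_braid (k := 2)); first exact: nesym.
    by rewrite -m_sym.
  apply: ceq_trans swap _; apply: rewrites_cons; exact: ceq_sq.
move=> /(rewrites_catr [:: j]) h.
apply: (@order_exact i j 1) => //; first by move=> l; rewrite mij => -[<-].
exact: ceq_trans h (ceq_sq _ j [::]).
Qed.

(* The state reached by a syllable word records an element of the Coxeter group
   (as a word) and, for each thick generator, the exponents of its successive
   syllables; since thick generators only take part in commutations, these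
   exponents are never reordered. *)
Definition state : Type := (seq I * (I -> nat -> int))%type.

(** The flag [d] tells whether [i] is a descent; if so, the exponent [a] of the leading [i]-syllable
    is popped, and otherwise [a] is 0. The Coxeter element is multiplied by [i] when exactly one of
    the old and new exponents vanishes. *)
Definition step i e (d : bool) s : bool * (nat -> int) :=
  if thick i then
    let a := if d then s 0 else 0%R in
    let rest := if d then (fun l => s l.+1) else s in
    let a' := norm_exp (f i) (a + e)%R in
    ((a == 0%R) != (a' == 0%R), if a' == 0%R then rest else streamcons a' rest)
  else (true, s).

Definition upd (L : I -> nat -> int) i s j := if j == i then s else L j.

Definition move i e (x : state) : state :=
  let st := step i e (descent x.1 i) (x.2 i) in
  (if st.1 then i :: x.1 else x.1, upd x.2 i st.2).

Definition good_stream (y : natbar) s :=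
  forall l, s l <> 0%R /\ norm_exp y (s l) = s l.

Definition good (x : state) := forall i, thick i -> good_stream (f i) (x.2 i).

Definition steq (x y : state) := ceq x.1 y.1 /\ forall i, thick i -> x.2 i = y.2 i.

Lemma steq_refl x : steq x x.
Proof. by split=> //; apply: rewrites_refl. Qed.

Lemma steq_sym x y : steq x y -> steq y x.
Proof. by case=> h1 h2; split=> [|i /h2 ->//]; apply: ceq_sym. Qed.

Lemma steq_trans y x z : steq x y -> steq y z -> steq x z.
Proof.
case=> h1 h2 [h3 h4]; split=> [|i ti]; first exact: ceq_trans h3.
by rewrite h2 // h4.
Qed.

Lemma step_thin i e d s : thick i = false -> step i e d s = (true, s).
Proof. by rewrite /step => ->. Qed.

Lemma steq_move i e x y : steq x y -> steq (move i e x) (move i e y).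
Proof.
case=> xy L; rewrite /move (descent_ceq i xy).
case ti : (thick i).
  rewrite (L i ti); set st := step _ _ _ _; split=> /=.
    by case: ifP => // _; apply: rewrites_cons.
  by move=> j tj; rewrite /upd; case: ifP => // _; apply: L.
rewrite !step_thin //; split=> /=; first exact: rewrites_cons.
move=> j tj; rewrite /upd; case: ifP => [/eqP e'|_]; last exact: L.
by rewrite -e' tj in ti.
Qed.

Lemma good_move i e x : good x -> good (move i e x).
Proof.
move=> gx j tj /=; rewrite /upd; case: eqP => [eji|_]; last exact: gx.
rewrite eji in tj *; have gi := gx i tj; rewrite /step tj /=.
set rest := if descent _ _ then fun _ => _ else _.
have grest : good_stream (f i) rest by rewrite /rest; case: ifP => // _ l; apply: gi.
case: eqP => // a'0 [|l] /=; last exact: grest.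
by split=> //; rewrite norm_expK.
Qed.

(** A leading [i]-syllable of exponent [a], possibly zero, in front of [w]. If [i] is not a descent
    of [w], a move by [i] merely adds to [a] modulo [f i]. *)
Definition put i w a s (L : I -> nat -> int) : state :=
  (if a == 0%R then w else i :: w,
   upd L i (if a == 0%R then s else streamcons a s)).

Lemma state_put i x : thick i -> good x -> exists w a s,
  [/\ descent w i = false, norm_exp (f i) a = a & steq x (put i w a s x.2)].
Proof.
move=> ti gx; case d : (descent x.1 i).
  have [L0 Ln] := gx i ti 0.
  exists (i :: x.1), (x.2 i 0), (fun l => x.2 i l.+1); split => //.
    by rewrite descent_cons d.
  rewrite /put (introF eqP L0); split=> /=.
    exact/ceq_sym/ceq_sq.
  move=> j tj; rewrite /upd; case: eqP => [->|//].
  by apply/funext; case.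
exists x.1, 0%R, (x.2 i); split => //; first exact: norm_exp0.
split=> /=; first exact: rewrites_refl.
by move=> j tj; rewrite /upd; case: eqP => [->|].
Qed.

Lemma updK L i s s' : upd (upd L i s) i s' = upd L i s'.
Proof. by apply/funext => j; rewrite /upd; case: eqP. Qed.

Lemma updE L i s : upd L i s i = s.
Proof. by rewrite /upd eqxx. Qed.

Lemma move_put i e w a s L : thick i -> descent w i = false ->
  steq (move i e (put i w a s L)) (put i w (norm_exp (f i) (a + e)%R) s L).
Proof.
move=> ti d; rewrite /move /put /= updE updK /step ti.
have [->|a0] := eqVneq a 0%R; rewrite ?descent_cons d /=.
  by rewrite eqxx; case: (norm_exp _ _ == _) => /=; apply: steq_refl.
rewrite (negPf a0); case: (norm_exp _ _ == _) => /=; last exact: steq_refl.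
by split=> //=; apply: ceq_sq.
Qed.

Lemma move_move i e e' x : thick i -> good x ->
  steq (move i e (move i e' x)) (move i (e' + e)%R x).
Proof.
move=> ti gx; have [w [a [s [d na xe]]]] := state_put ti gx.
apply: steq_trans (steq_move i e (steq_move i e' xe)) _.
apply: steq_trans (steq_move i e (move_put e' a s x.2 ti d)) _.
apply: steq_trans (move_put e _ s x.2 ti d) _.
rewrite norm_exp_addl -addrA; apply: steq_sym.
exact: steq_trans (steq_move i _ xe) (move_put _ a s x.2 ti d).
Qed.

Lemma move_eq0 i e x : thick i -> good x ->
  (forall a, norm_exp (f i) (a + e)%R = norm_exp (f i) a) -> steq (move i e x) x.
Proof.
move=> ti gx he; have [w [a [s [d na xe]]]] := state_put ti gx.
apply: steq_trans (steq_move i e xe) _.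
apply: steq_trans (move_put e a s x.2 ti d) _.
by rewrite he na; apply: steq_sym.
Qed.

Lemma move_commute i j e e' x : i <> j -> m i j = Fin 2 ->
  steq (move i e (move j e' x)) (move j e' (move i e x)).
Proof.
move=> nij mij; case: x => w L; rewrite /move /=.
have mji : m j i = Fin 2 by rewrite -m_sym.
have nji := nesym nij.
set sj := step j e' (descent w j) (L j).
set si := step i e (descent w i) (L i).
have -> : upd L j sj.2 i = L i by rewrite /upd (introF eqP nij).
have -> : upd L i si.2 j = L j by rewrite /upd (introF eqP nji).
have -> : descent (if sj.1 then j :: w else w) i = descent w i.
  by case: ifP => // _; apply: descent_commute.
have -> : descent (if si.1 then i :: w else w) j = descent w j.
  by case: ifP => // _; apply: descent_commute.
rewrite -/sj -/si; split => /=.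
  case: sj.1; case: si.1; try exact: rewrites_refl.
  apply: (@rewrites_catr _ _ w [:: i; j] [:: j; i]); apply/rewrites_rel.
  exact: (coxeter_braid (k := 2)).
move=> l _; rewrite /upd; case: eqP => [->|//]; case: eqP => [/nij|] //.
Qed.

Definition letter_exp (b : bool) : int := if b then (-1)%R else 1%R.

Definition act (u : word I) (x : state) : state :=
  foldr (fun l => move l.1 (letter_exp l.2)) x u.

Lemma act_cat u v x : act (u ++ v) x = act u (act v x).
Proof. exact: foldr_cat. Qed.

Lemma steq_act u x y : steq x y -> steq (act u x) (act u y).
Proof. by move=> xy; elim: u => [//|l u IH] /=; apply: steq_move. Qed.

Lemma good_act u x : good x -> good (act u x).
Proof. by move=> gx; elim: u => [//|l u IH] /=; apply: good_move. Qed.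

Lemma act_nseq k i b x : thick i -> good x ->
  steq (act (nseq k (i, b)) x) (move i (letter_exp b * k%:Z)%R x).
Proof.
move=> ti gx; elim: k => [|k IH] /=.
  by apply: steq_sym; apply: move_eq0 => // a; rewrite mulr0 addr0.
apply: steq_trans (steq_move i _ IH) _.
apply: steq_trans (move_move _ _ ti gx) _.
rewrite (_ : (_ + _)%R = (letter_exp b * k.+1%:Z)%R); first exact: steq_refl.
by rewrite -addn1 PoszD mulrDr mulr1.
Qed.

Lemma act_thin (w : seq I) x : (forall i, i \in w -> thick i = false) ->
  steq (act [seq (i, false) | i <- w] x) (w ++ x.1, x.2).
Proof.
elim: w => [|i w IH] thin_w /=; first by case: x => ? ?; apply: steq_refl.
have ti : thick i = false by apply: thin_w; rewrite inE eqxx.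
have {}IH := IH (fun j jw => thin_w j (mem_behead (s := i :: w) jw)).
apply: steq_trans (steq_move i _ IH) _.
rewrite /move /= step_thin //; split => /=; first exact: rewrites_refl.
by move=> j tj; rewrite /upd; case: eqP => // e; rewrite -e tj in ti.
Qed.

Lemma alternatingE i j k : alternating i j k = [seq (l, false) | l <- alt i j k].
Proof.
by rewrite map_alt; apply: eq_map => l; case: (odd l).
Qed.

Lemma mem_alt i j k l : l \in alt i j k -> l = i \/ l = j.
Proof. by case/mapP => h _ ->; case: (odd h); [right|left]. Qed.

Theorem act_presented u v : presented_eq (dyer_relation f m) u v ->
  forall x, good x -> steq (act u x) (act v x).
Proof.
elim=> {u v} [u v [i k fi|i j k nij mij]|i b|u|u v _ IH|u v w _ IH1 _ IH2|
  u1 v1 u2 v2 _ IH1 _ IH2] x gx.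
- case ti : (thick i).
    apply: steq_trans (act_nseq k false ti gx) _.
    by apply: move_eq0 => // a; rewrite fi mul1r norm_exp_addk.
  have := thinE ti; rewrite fi => -[->] /=.
  rewrite /move /= !step_thin //; split => /=; first exact: ceq_sq.
  by move=> j tj; rewrite /upd; case: eqP => // e; rewrite -e tj in ti.
- rewrite !alternatingE.
  case tij : (thick i || thick j); last first.
    move/norP: tij => [/negPf ti /negPf tj].
    apply: steq_trans (act_thin _ _) _.
      by move=> l /mem_alt [] ->.
    apply: steq_sym; apply: steq_trans (act_thin _ _) _.
      by move=> l /mem_alt [] ->.
    split=> //=; apply/rewrites_catr/rewrites_rel.
    apply: coxeter_braid; [exact: nesym|by rewrite -m_sym].
  (* For a thick generator 2 is the only finite value of [m], so the relation is a commutation. *)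
  have k2 : k = 2.
    by have := m_2oo nij (orP tij); rewrite mij => -[[]|].
  rewrite k2 in mij *; exact: move_commute.
- case ti : (thick i).
    apply: steq_trans (move_move _ _ ti gx) _.
    by apply: move_eq0 => // a; case: b; rewrite /= ?addNr ?subrr ?addr0.
  rewrite /= /move /= !step_thin //; split => /=; first exact: ceq_sq.
  by move=> j tj; rewrite /upd; case: eqP => // e; rewrite -e tj in ti.
- exact: steq_refl.
- exact/steq_sym/IH.
- exact: steq_trans (IH1 x gx) (IH2 x gx).
- rewrite !act_cat; apply: steq_trans (steq_act u1 (IH2 x gx)) _.
  exact/IH1/good_act.
Qed.

End Action.

(** * Syllable words *)

Lemma map_eq_cat (A B : Type) (g : A -> B) u x y : map g u = x ++ y ->
  exists x' y', [/\ u = x' ++ y', map g x' = x & map g y' = y].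
Proof.
move=> e; exists (take (size x) u), (drop (size x) u); split.
- by rewrite cat_take_drop.
- by rewrite map_take e take_size_cat.
- by rewrite map_drop e drop_size_cat.
Qed.

Section Syllables.
Variables (I : eqType) (f : I -> natbar) (m : I -> I -> natbar).

Implicit Types (u v : seq (I * int)) (i j : I).

Definition unit_syllables (w : seq I) : seq (I * int) := [seq (i, 1%R) | i <- w].

(** Braid moves with finite [m i j] at least 3 involve only thin generators, whose only balanced
    exponent is 1; commutations allow any exponents. *)
Inductive syllable_rel : seq (I * int) -> seq (I * int) -> Prop :=
| syllable_swap i j a b : i <> j -> m i j = Fin 2 ->
    syllable_rel [:: (i, a); (j, b)] [:: (j, b); (i, a)]
| syllable_braid i j k : i <> j -> m i j = Fin k ->
    syllable_rel (unit_syllables (alt i j k)) (unit_syllables (alt j i k)).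

Definition syllable_valid u := all (fun p => balanced (f p.1) p.2) u.

Definition syllable_reduced u := syllable_valid u /\
  forall v, rewrites syllable_rel u v ->
  forall x i a b y, v <> x ++ [:: (i, a); (i, b)] ++ y.

Definition syllable_weight u := sumn [seq `|p.2|%N | p <- u].

Definition letters u : word I :=
  flatten [seq nseq `|p.2|%N (p.1, (p.2 < 0)%R) | p <- u].

Lemma size_letters u : size (letters u) = syllable_weight u.
Proof.
rewrite size_flatten /shape -map_comp; congr sumn.
by apply: eq_map => p; rewrite /= size_nseq.
Qed.

Lemma letters_cat u v : letters (u ++ v) = letters u ++ letters v.
Proof. by rewrite /letters map_cat flatten_cat. Qed.

Lemma syllable_weight_cat u v :
  syllable_weight (u ++ v) = syllable_weight u + syllable_weight v.
Proof. by rewrite /syllable_weight map_cat sumn_cat. Qed.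

Lemma syllable_weight_unit w : syllable_weight (unit_syllables w) = size w.
Proof. by elim: w => //= i w <-. Qed.

Lemma syllable_weight_rewrites u v : rewrites syllable_rel u v ->
  syllable_weight u = syllable_weight v.
Proof.
apply: rewrites_invariant => x l l' y rl; rewrite !syllable_weight_cat.
congr (_ + (_ + _)); case: rl => [i j a b _ _|i j k _ _].
  by rewrite /syllable_weight /= !addn0 addnC.
by rewrite !syllable_weight_unit !size_alt.
Qed.

Lemma syllable_reduced_rewrites u v :
  syllable_valid u = syllable_valid v ->
  syllable_reduced u -> rewrites syllable_rel u v -> syllable_reduced v.
Proof.
move=> uv [vu ru] ruv; split=> [|w vw]; first by rewrite -uv.
by apply: ru; apply: rewrites_trans vw.
Qed.

Hypothesis f_ge2 : forall i, le_natbar (Fin 2) (f i).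

Lemma balanced1 i : balanced (f i) 1.
Proof. by have := f_ge2 i; case: (f i) => [k|] //= k2; rewrite /balanced; lia. Qed.

Lemma syllable_valid_unit w : syllable_valid (unit_syllables w).
Proof. by apply/allP => _ /mapP [i _ ->]; apply: balanced1. Qed.

Lemma syllable_valid_rewrites u v : rewrites syllable_rel u v ->
  syllable_valid u = syllable_valid v.
Proof.
apply: rewrites_invariant => x l l' y rl; rewrite /syllable_valid !all_cat.
congr (_ && (_ && _)); case: rl => [i j a b _ _|i j k _ _].
  by rewrite /= !andbT andbC.
by rewrite -!/(syllable_valid _) !syllable_valid_unit.
Qed.

Hypothesis m_sym : forall i j, i <> j -> m i j = m j i.
Hypothesis m_ge2 : forall i j, i <> j -> le_natbar (Fin 2) (m i j).
Hypothesis m_2oo : forall i j, i <> j ->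
  le_natbar (Fin 3) (f i) \/ le_natbar (Fin 3) (f j) ->
  m i j = Fin 2 \/ m i j = Infty.

Lemma balanced_thin i a : thick f i = false -> balanced (f i) a -> a = 1.
Proof.
by move=> /(thinE f_ge2) ->; rewrite /balanced => /andP [? /andP []]; lia.
Qed.

Lemma braid_lift_rel i j k u : i <> j -> m i j = Fin k -> syllable_valid u ->
  unzip1 u = alt i j k ->
  exists2 v, rewrites syllable_rel u v & unzip1 v = alt j i k.
Proof.
move=> nij mij vu eu.
have [k2|k2] := eqVneq k 2.
  rewrite k2 in mij eu *; case: u vu eu => [|[i' a] [|[j' b] [|]]] //= _ [-> ->].
  by exists [:: (j, b); (i, a)] => //; apply/rewrites_rel/syllable_swap.
have [ti tj] : thick f i = false /\ thick f j = false.
  have no : ~ (le_natbar (Fin 3) (f i) \/ le_natbar (Fin 3) (f j)).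
    by move=> /(m_2oo nij); rewrite mij => -[[/eqP]|//]; rewrite (negPf k2).
  by split; apply/negP => h; apply: no; [left|right].
exists (unit_syllables (alt j i k)); last first.
  by rewrite /unzip1 /unit_syllables -map_comp map_id.
suff -> : u = unit_syllables (alt i j k) by exact/rewrites_rel/syllable_braid.
rewrite -eu /unit_syllables /unzip1 -map_comp -[LHS]map_id.
apply/eq_in_map => -[l a] lu /=; congr pair.
apply: (@balanced_thin l); last exact: (allP vu _ lu).
have : l \in alt i j k by rewrite -eu; apply/mapP; exists (l, a).
by move=> /mem_alt [] ->.
Qed.

Lemma braid_lift w w' : rewrites (braid_rel m) w w' ->
  forall u, syllable_valid u -> unzip1 u = w ->
  exists2 v, rewrites syllable_rel u v & unzip1 v = w'.
Proof.
elim=> [w0|x l l' y v rl _ IH] u vu eu; first by exists u => //; apply: rewrites_refl.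
have [x' [ly' [eu1 ex /map_eq_cat [l1 [y' [ely el ey]]]]]] := map_eq_cat eu.
rewrite {}ely in eu1.
have vl1 : syllable_valid l1.
  by move: vu; rewrite eu1 /syllable_valid !all_cat => /and3P [].
have [l2 r12 el2] : exists2 l2, rewrites syllable_rel l1 l2 & unzip1 l2 = l'.
  by case: rl el => i j k nij mij; apply: braid_lift_rel.
have r : rewrites syllable_rel u (x' ++ l2 ++ y').
  by rewrite eu1; apply/rewrites_catl/rewrites_catr.
have [||v' rv' ev'] := IH (x' ++ l2 ++ y').
- by rewrite -(syllable_valid_rewrites r).
- by rewrite /unzip1 !map_cat -/(unzip1 l2) ex el2 ey.
by exists v' => //; apply: rewrites_trans rv'.
Qed.

(** A square exposed by braid moves on the generators would lift to two adjacent syllables of one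
    generator. *)
Lemma syllable_reduced_braid u : syllable_reduced u -> braid_reduced m (unzip1 u).
Proof.
move=> [vu ru] w uw x i y ew.
have [v uv ev] := braid_lift uw vu erefl.
have [x' [l' [ev1 _ /(@map_eq_cat _ _ _ _ [:: i; i]) [l1 [y' [el el1 _]]]]]] :=
  map_eq_cat (etrans ev ew).
case: l1 el el1 => [|[i1 a] [|[i2 b] [|]]] //= el [e1 e2].
by apply: (ru v uv x' i a b y'); rewrite ev1 el e1 e2.
Qed.

Hypothesis order_exact : forall i j k, i <> j -> 0 < k ->
  (forall l, m i j = Fin l -> k < l) ->
  ~ rewrites (coxeter_rel m) (alt i j k.*2) [::].

(** The streams that [letters u] produces from the base state, whose constant 1 forms the tail. *)
Fixpoint exponents u : I -> nat -> int :=
  if u is (i, a) :: u' then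
    upd (exponents u') i (streamcons (norm_exp (f i) a) (exponents u' i))
  else fun _ _ => 1%R.

Definition base_state : state I := ([::], fun _ _ => 1%R).

Lemma good_base : good f base_state.
Proof. by move=> i ti l; rewrite norm_exp_small. Qed.

(** In a minimal word no generator is a descent of what follows it, so each thick syllable is pushed
    as a new entry and never merges. *)
Lemma act_letters u : syllable_valid u -> minimal m (unzip1 u) ->
  steq f m (act f m (letters u) base_state) (unzip1 u, exponents u).
Proof.
elim: u => [|[i a] u IH] vu mu; first exact: steq_refl.
have [ba vu'] : balanced (f i) a /\ syllable_valid u by apply/andP.
have mu' : minimal m (unzip1 u) by apply: minimal_behead mu.
have d : descent m (unzip1 u) i = false by apply: minimal_parity_behead.
rewrite [letters _]/(nseq _ _ ++ letters u) act_cat.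
have {}IH := IH vu' mu'.
case ti : (thick f i).
  have gst := good_act m (letters u) good_base.
  apply: steq_trans (act_nseq m_sym `|a| (a < 0)%R ti gst) _.
  apply: steq_trans (steq_move m_sym i _ IH) _.
  rewrite (_ : (_ * _)%R = a); last by rewrite /letter_exp; case: ifP => /=; lia.
  rewrite /move /= d /step ti /= add0r eqxx.
  rewrite (negPf (balanced_norm_neq0 ba)); exact: steq_refl.
apply: steq_trans (steq_act m_sym _ IH) _.
rewrite (balanced_thin ti ba) /= /move /= step_thin //.
split=> /=; first exact: rewrites_refl.
by move=> j tj; rewrite /upd; case: eqP => // e; rewrite -e tj in ti.
Qed.

Lemma exponents_inj u v : syllable_valid u -> syllable_valid v ->
  unzip1 u = unzip1 v ->
  (forall i, thick f i -> exponents u i = exponents v i) -> u = v.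
Proof.
elim: u v => [|[i a] u IH] [|[j b] v] //= /andP [ba vu] /andP [bb vv] [ij uv] e.
rewrite -{}ij in bb e *.
have ab : a = b.
  case ti : (thick f i); last by rewrite (balanced_thin ti ba) (balanced_thin ti bb).
  apply: (balanced_norm_inj ba bb).
  by have := congr1 (fun s => s 0) (e i ti); rewrite !updE.
rewrite ab (IH v) // => l tl; have := e l tl; rewrite /upd; case: eqP => // -> h.
by apply/funext => k; have := congr1 (fun s => s k.+1) h.
Qed.

(** The orbit of the base state gives equal Coxeter elements, hence braid moves on the generators.
    Lifted to syllables, these end at a word with the generators of [v], and the streams identify
    its exponents. *)
Theorem syllable_reduced_unique u v :
  syllable_reduced u -> syllable_reduced v ->
  presented_eq (dyer_relation f m) (letters u) (letters v) ->
  (forall w, rewrites syllable_rel u w ->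
     presented_eq (dyer_relation f m) (letters u) (letters w)) ->
  rewrites syllable_rel u v.
Proof.
move=> ru rv uv upres.
have st w : syllable_reduced w ->
    steq f m (act f m (letters w) base_state) (unzip1 w, exponents w).
  move=> rw; apply: act_letters; first by case: rw.
  by apply: braid_reduced_minimal => //; apply: syllable_reduced_braid.
have same w w' : syllable_reduced w -> syllable_reduced w' ->
    presented_eq (dyer_relation f m) (letters w) (letters w') ->
    steq f m (unzip1 w, exponents w) (unzip1 w', exponents w').
  move=> rw rw' ww'; apply: steq_trans (steq_sym m_sym (st w rw)) _.
  by apply: steq_trans (st w' rw'); apply: act_presented => //; apply: good_base.
have buv : rewrites (braid_rel m) (unzip1 u) (unzip1 v).
  apply: braid_reduced_ceq => //; try exact: syllable_reduced_braid.
  by case: (same u v ru rv uv).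
have [w uw ew] := braid_lift buv (proj1 ru) erefl.
have rw : syllable_reduced w.
  exact: (syllable_reduced_rewrites (syllable_valid_rewrites uw) ru uw).
suff <- : w = v by [].
apply: exponents_inj => //; [by case: rw|by case: rv|].
apply: (proj2 (same w v rw rv _)).
exact: presented_trans (presented_sym (upres w uw)) uv.
Qed.

End Syllables.

(** * Shortest exponents and integer powers *)

Definition balance (x : natbar) (a : int) : int :=
  if x is Fin k then
    let r := (a %% k%:Z)%Z in if (r + r <= k%:Z)%R then r else (r - k%:Z)%R
  else a.

Lemma balanceP x a : le_natbar (Fin 2) x ->
  (balance x a == 0%R) || balanced x (balance x a).
Proof.
case: x => [k|] /= k2; last by rewrite /balanced andbT; case: eqP.
rewrite /balanced; case: eqP => //= _.
have k0 : (k%:Z != 0)%R by lia.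
have := modz_ge0 a k0; have := ltz_mod a k0.
by set r := (a %% _)%Z; case: ifP; lia.
Qed.

Lemma balance_le x a : le_natbar (Fin 2) x -> `|balance x a|%N <= `|a|%N.
Proof.
case: x => [k|] //= k2.
have k0 : (k%:Z != 0)%R by lia.
have := modz_ge0 a k0; have := ltz_mod a k0; have := divz_eq a k%:Z.
set r := (a %% _)%Z; set q := (a %/ _)%Z => ea rk r0.
have [q0|q0|q0] := ltrgtP q 0%R; case: ifP => h; nia.
Qed.

Section IntegerPower.
Local Open Scope group_scope.
Variable G : groupType.
Implicit Types (x y : G) (a b : int).

Definition zpow x a : G :=
  match a with Posz k => x ^+ k | Negz k => x^-1 ^+ k.+1 end.

Lemma zpowS x a : zpow x (a + 1)%R = zpow x a * x.
Proof.
case: a => k.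
  by rewrite -PoszD addn1 /= expgSr.
case: k => [|k]; first by rewrite /= expg1 mulVg.
rewrite (_ : (_ + 1)%R = Negz k); last lia.
by rewrite /= [in RHS]expgSr mulgVK.
Qed.

Lemma zpowP x a : zpow x (a - 1)%R = zpow x a * x^-1.
Proof. by rewrite -{2}[a](subrK 1%R) zpowS mulgK. Qed.

Lemma zpowD x a b : zpow x (a + b)%R = zpow x a * zpow x b.
Proof.
case: b => k.
  elim: k => [|k IH]; first by rewrite addr0 /= mulg1.
  by rewrite -addn1 PoszD addrA !zpowS IH mulgA.
elim: k => [|k IH].
  by rewrite (_ : Negz 0 = (-1)%R) // zpowP /= expg1.
rewrite (_ : Negz k.+1 = (Negz k - 1)%R); last lia.
by rewrite addrA !zpowP IH mulgA.
Qed.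

Lemma commute_zpow x y a b : commute x y -> commute (zpow x a) (zpow y b).
Proof.
move=> xy; have yx := commute_sym xy.
have xVy : commute x^-1 y by apply: commute_sym; apply: commuteV.
by case: a b => [k|k] [l|l] /=; apply: commuteX2 => //; apply: commuteV.
Qed.

Lemma zpow_mul x (k : nat) a : x ^+ k = 1 -> zpow x (a * k%:Z)%R = 1.
Proof.
move=> xk; case: a => l.
  by rewrite -PoszM /= mulnC expgnA xk expg1n.
rewrite NegzE mulNr -PoszM.
case: (l.+1 * k)%N (mulnC l.+1 k) => [//|h eh].
by rewrite -NegzE /= eh expgnA expVgn xk invg1 expg1n.
Qed.

Lemma zpow_balance x (z : natbar) a : (forall k, z = Fin k -> x ^+ k = 1) ->
  zpow x (balance z a) = zpow x a.
Proof.
case: z => [k|] //= /(_ k erefl) xk.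
rewrite [in RHS](divz_eq a k%:Z) zpowD zpow_mul // mul1g.
by case: ifP => // _; rewrite zpowD -mulN1r zpow_mul // mulg1.
Qed.

End IntegerPower.

(** * Evaluation of words and word length *)

Section EvalWord.
Variables (I : Type) (G : groupType) (s : I -> G).

Lemma eval_word_cat (u v : word I) :
  eval_word s (u ++ v) = (eval_word s u * eval_word s v)%g.
Proof. exact: big_cat. Qed.

Lemma eval_word_nil : eval_word s [::] = 1%g.
Proof. exact: big_nil. Qed.

Lemma eval_word_nseq k l : eval_word s (nseq k l) = (eval_letter s l ^+ k)%g.
Proof.
elim: k => [|k IH]; first exact: eval_word_nil.
by rewrite [LHS]big_cons expgS -IH.
Qed.

End EvalWord.

Lemma word_length_spec (I : finType) (G : groupType) (s : I -> G) (x : G) :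
  generates s ->
  (exists w, size w = word_length s x /\ eval_word s w = x) /\
  (forall w, eval_word s w = x -> word_length s x <= size w).
Proof.
move=> gen; rewrite /word_length; case: pselect => [h|no]; last first.
  exfalso; apply: no; have [w ew] := gen x.
  by exists (size w); apply/asboolP; exists w.
case: ex_minnP => k /asboolP hk kmin; split=> // w ew.
by apply: kmin; apply/asboolP; exists w.
Qed.

(** * Geodesics and reduced syllable words *)

Section SyllableEval.
Variables (n : nat) (D : groupType) (s : 'I_n -> D).
Variables (f : 'I_n -> natbar) (m : 'I_n -> 'I_n -> natbar).
Hypothesis hD : dyer_system s f m.

Let f_ge2 := dyer_f_ge2 hD.
Let m_sym := dyer_m_sym hD.
Let m_ge2 := dyer_m_ge2 hD.
Let m_2oo := dyer_m_2oo hD.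

Definition syllable_eval (u : seq ('I_n * int)) : D := eval_word s (letters u).

Lemma syllable_eval_cat u v :
  syllable_eval (u ++ v) = (syllable_eval u * syllable_eval v)%g.
Proof. by rewrite /syllable_eval letters_cat eval_word_cat. Qed.

Lemma syllable_eval1 i a : syllable_eval [:: (i, a)] = zpow (s i) a.
Proof.
by rewrite /syllable_eval /letters /= cats0 eval_word_nseq; case: a.
Qed.

Lemma eval_presented u v :
  eval_word s u = eval_word s v <-> presented_eq (dyer_relation f m) u v.
Proof. by case: (dyer_presentation hD) => _ h; apply: h. Qed.

Lemma generator_order i k : f i = Fin k -> (s i ^+ k)%g = 1%g.
Proof.
move=> fi; rewrite -(eval_word_nil s) -[s i]/(eval_letter s (i, false)) -eval_word_nseq.
exact/eval_presented/presented_rel/dyer_power.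
Qed.

Lemma generator_commute i j : i <> j -> m i j = Fin 2 -> commute (s i) (s j).
Proof.
move=> nij mij.
have /eval_presented : presented_eq (dyer_relation f m)
    (alternating i j 2) (alternating j i 2) by exact/presented_rel/dyer_braid.
by rewrite /eval_word !big_cons !big_nil /= !mulg1.
Qed.

Lemma letters_unit (w : seq 'I_n) :
  letters (unit_syllables w) = [seq (i, false) | i <- w].
Proof. by elim: w => //= i w IH; rewrite -IH. Qed.

Lemma syllable_eval_rewrites u v : rewrites (syllable_rel m) u v ->
  syllable_eval u = syllable_eval v.
Proof.
apply: rewrites_invariant => x l l' y rl; rewrite !syllable_eval_cat.
congr (_ * (_ * _))%g; case: rl => [i j a b nij mij|i j k nij mij].
  rewrite -cat1s syllable_eval_cat !syllable_eval1.
  rewrite -[RHS]/(syllable_eval ([:: _] ++ [:: _])).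
  rewrite syllable_eval_cat !syllable_eval1.
  exact/commute_zpow/generator_commute.
rewrite /syllable_eval !letters_unit -!alternatingE.
exact/eval_presented/presented_rel/dyer_braid.
Qed.

Theorem syllable_reduced_eval_inj u v :
  syllable_reduced f m u -> syllable_reduced f m v ->
  syllable_eval u = syllable_eval v -> rewrites (syllable_rel m) u v.
Proof.
move=> ru rv uv; apply: (syllable_reduced_unique f_ge2) => //.
- exact: coxeter_order_exact.
- exact/eval_presented.
- by move=> w /syllable_eval_rewrites uw; apply/eval_presented.
Qed.

Lemma merge_syllables i a b : exists v,
  [/\ syllable_valid f v, syllable_eval v = syllable_eval [:: (i, a); (i, b)],
      syllable_weight v <= syllable_weight [:: (i, a); (i, b)] & size v <= 1].
Proof.
have e : syllable_eval [:: (i, a); (i, b)] = zpow (s i) (balance (f i) (a + b)%R).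
  rewrite -cat1s syllable_eval_cat !syllable_eval1 -zpowD zpow_balance //.
  exact: generator_order.
have le := balance_le (a + b)%R (f_ge2 i).
have := balanceP (a + b)%R (f_ge2 i); have [b0 _|b0 /= bal] := eqVneq (balance _ _) 0%R.
  exists [::]; split=> //; rewrite e b0; exact: eval_word_nil.
exists [:: (i, balance (f i) (a + b)%R)]; split=> //=.
- by rewrite /syllable_valid /= bal.
- by rewrite e syllable_eval1.
- by rewrite /syllable_weight /=; lia.
Qed.

(** Each letter becomes a syllable with balanced exponent; the inverse letter of an involution thus
    gets exponent 1. *)
Lemma ex_valid (w : word 'I_n) : exists u,
  [/\ syllable_valid f u, syllable_eval u = eval_word s w & syllable_weight u <= size w].
Proof.
elim: w => [|[i b] w [u [vu eu su]]]; first by exists [::].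
pose e : int := if b then (-1)%R else 1%R.
have ee : zpow (s i) e = eval_letter s (i, b).
  by rewrite /e /eval_letter; case: (b) => /=; rewrite expg1.
have le := balance_le e (f_ge2 i).
have es : `|e|%N = 1 by rewrite /e; case: (b).
have := balanceP e (f_ge2 i); have [b0 _|b0 /= bal] := eqVneq (balance _ _) 0%R.
  exists u; split=> //=; last exact: leqW.
  rewrite [RHS]big_cons -/(eval_word s w) -eu -ee.
  rewrite -(zpow_balance (z := f i)) ?b0 ?mul1g //.
  exact: generator_order.
exists ((i, balance (f i) e) :: u); split=> /=.
- by rewrite bal.
- rewrite -cat1s syllable_eval_cat syllable_eval1 [RHS]big_cons -/(eval_word s w) -eu -ee.
  by rewrite zpow_balance //; apply: generator_order.
- by rewrite /syllable_weight /= -/(syllable_weight u); lia.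
Qed.

(** Take a valid word for [x] of weight at most its length with the fewest syllables. If moves made
    two syllables of one generator adjacent, merging them would lower the number of syllables
    without raising the weight. *)
Theorem ex_reduced (x : D) : exists u,
  [/\ syllable_reduced f m u, syllable_eval u = x & syllable_weight u = word_length s x].
Proof.
have [[w [sw ew]] wmin] := word_length_spec x (proj1 (dyer_presentation hD)).
pose P k := `[< exists u, [/\ size u = k, syllable_valid f u, syllable_eval u = x &
  syllable_weight u <= word_length s x] >].
have exP : exists k, P k.
  have [u [vu eu su]] := ex_valid w.
  by exists (size u); apply/asboolP; exists u; rewrite -sw -ew.
case: (ex_minnP exP) => k /asboolP [u [su vu eu wu]] kmin.
exists u; split=> //; last first.
  by apply/eqP; rewrite eqn_leq wu -size_letters wmin.
split=> // v uv y i a b z ev.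
have [c [vc ec wc sc]] := merge_syllables i a b.
suff : k <= size (y ++ c ++ z).
  have := congr1 size ev; rewrite -(_ : size u = size v); last first.
    apply: (@rewrites_invariant _ _ _ size _ u v uv) => t l l' h rl.
    by rewrite !size_cat; case: rl => // ? ? ? _ _; rewrite !size_map.
  by rewrite !size_cat su => ->; rewrite leq_add2l leq_add2r leqNgt ltnS sc.
apply: kmin; apply/asboolP; exists (y ++ c ++ z); split=> //.
- move: vu; rewrite (syllable_valid_rewrites f_ge2 uv) ev /syllable_valid !all_cat.
  by move=> /and3P [-> _ ->]; rewrite -/(syllable_valid f c) vc.
- by rewrite -eu (syllable_eval_rewrites uv) ev !syllable_eval_cat ec.
- apply: leq_trans wu; rewrite (syllable_weight_rewrites uv) ev !syllable_weight_cat.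
  by rewrite leq_add2l leq_add2r.
Qed.

(** Some reduced word of the element is geodesic, and moves between reduced words preserve the
    weight. *)
Theorem word_length_reduced u : syllable_reduced f m u ->
  word_length s (syllable_eval u) = syllable_weight u.
Proof.
move=> ru; have [v [rv ev <-]] := ex_reduced (syllable_eval u).
exact/esym/syllable_weight_rewrites/syllable_reduced_eval_inj.
Qed.

End SyllableEval.

(** * Comparison of Dyer systems *)

Section Comparison.
Variables (I J : eqType) (f : I -> natbar) (m : I -> I -> natbar).
Variables (f' : J -> natbar) (m' : J -> J -> natbar) (phi : I -> J).
Hypothesis f_ge2 : forall i, le_natbar (Fin 2) (f i).
Hypothesis m_sym : forall i j, i <> j -> m i j = m j i.
Hypothesis m_ge2 : forall i j, i <> j -> le_natbar (Fin 2) (m i j).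
Hypothesis m'_ge2 : forall i j, i <> j -> le_natbar (Fin 2) (m' i j).
Hypothesis phi_inj : injective phi.
Hypothesis phi_f : forall i, le_natbar (f i) (f' (phi i)).
Hypothesis phi_m : forall i j, i <> j -> le_natbar (m i j) (m' (phi i) (phi j)).

Implicit Types (u v : seq (I * int)).

Definition syllable_map u : seq (J * int) := [seq (phi p.1, p.2) | p <- u].

Lemma syllable_map_inj : injective syllable_map.
Proof. by apply: inj_map => -[i a] [j b] /= [/phi_inj -> ->]. Qed.

Lemma syllable_map_cat u v :
  syllable_map (u ++ v) = syllable_map u ++ syllable_map v.
Proof. exact: map_cat. Qed.

Lemma syllable_map_unit w :
  syllable_map (unit_syllables w) = unit_syllables (map phi w).
Proof. by rewrite /syllable_map /unit_syllables -!map_comp. Qed.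

Lemma syllable_weight_map u : syllable_weight (syllable_map u) = syllable_weight u.
Proof. by rewrite /syllable_weight -map_comp. Qed.

Lemma syllable_valid_map u : syllable_valid f u -> syllable_valid f' (syllable_map u).
Proof.
rewrite /syllable_valid all_map; apply: sub_all => -[i a] /=.
rewrite /balanced => /andP [-> /=]; have := phi_f i.
by case: (f i) (f' (phi i)) => [k|] [k'|] //= kk'; lia.
Qed.

Lemma map_alt_phi i j k : map phi (alt i j k) = alt (phi i) (phi j) k.
Proof. by rewrite map_alt. Qed.

(** Since [k > 1], both [i'] and [j'] occur in the word, so both have preimages. *)
Lemma syllable_map_braid u (i' j' : J) k : 1 < k ->
  syllable_map u = unit_syllables (alt i' j' k) ->
  exists i j, [/\ i' = phi i, j' = phi j & u = unit_syllables (alt i j k)].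
Proof.
case: k => [|[|k]] // _ e; move: (e); rewrite !altS.
case: u e => [|[i a] [|[j b] u]] // e [ei _ ej _ _].
exists i, j; split=> //; apply: syllable_map_inj; apply: (etrans e).
by rewrite -ei -ej -map_alt_phi -syllable_map_unit.
Qed.

(* A braid move of length [k'] on the image of a reduced word [u] comes from a
   pair with [m i j = Fin k] and [k <= k']; if [k < k'], a braid move in the
   middle of the alternating factor would bring two [i]-syllables together. *)
Lemma syllable_rel_lift x l y l' : syllable_reduced f m (x ++ l ++ y) ->
  syllable_rel m' (syllable_map l) l' ->
  exists2 l0, rewrites (syllable_rel m) l l0 & l' = syllable_map l0.
Proof.
move=> [_ red]; move e : (syllable_map l) => L rL.
case: rL e => [i' j' a b nij' mij'|i' j' k' nij' mij'] e.
  case: l e red => [|[i a'] [|[j b'] [|]]] //= [ei ea ej eb] _.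
  have nij : i <> j by move=> eij; apply: nij'; rewrite -ei -ej eij.
  exists [:: (j, b); (i, a)]; last by rewrite /= ei ej.
  rewrite ea eb; apply/rewrites_rel/syllable_swap => //.
  have := phi_m nij; have := m_ge2 nij; rewrite ei ej mij'.
  by case: (m i j) => [k|] //= k2 k2'; congr Fin; lia.
have k'2 : 1 < k' by have := m'_ge2 nij'; rewrite mij'.
have [i [j [ei ej el]]] := syllable_map_braid k'2 e.
have nij : i <> j by move=> eij; apply: nij'; rewrite ei ej eij.
have := phi_m nij; have := m_ge2 nij; rewrite -ei -ej mij'.
case mij : (m i j) => [k|] //= k2 kk'.
have [ek|kltk'] : k = k' \/ k < k' by lia.
  exists (unit_syllables (alt j i k')).
    by rewrite el; apply/rewrites_rel/syllable_braid => //; rewrite mij ek.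
  by rewrite syllable_map_unit map_alt_phi ei ej.
exfalso; case: k k2 mij kk' kltk' => // k k2 mij kk' kltk'.
pose r := if odd k.+2 then alt j i (k' - k.+2) else alt i j (k' - k.+2).
have el' : l = [:: (i, 1%R)] ++ unit_syllables (alt j i k.+1) ++ unit_syllables r.
  rewrite el -(subnKC kltk') alt_cat -/r altS.
  by rewrite /unit_syllables /= map_cat.
apply: (red _ _ x i 1%R 1%R (unit_syllables (alt j i k) ++ unit_syllables r ++ y)).
  apply: rewrites_catl; rewrite el' -!catA; apply: rewrites_catl.
  apply: rewrites_catr; apply/rewrites_rel/syllable_braid; first exact: nesym.
  by rewrite -m_sym.
by rewrite altS.
Qed.

(** Along a chain of moves for [m'], each word is again the image of a reduced word, so the lifting
    continues. *)
Lemma syllable_lift w w' : rewrites (syllable_rel m') w w' ->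
  forall u, syllable_reduced f m u -> w = syllable_map u ->
  exists2 v, rewrites (syllable_rel m) u v & w' = syllable_map v.
Proof.
elim=> [w0|x l l' y v rl _ IH] u ru eu.
  by exists u => //; apply: rewrites_refl.
have [x0 [ly [eu1 ex /map_eq_cat [l0 [y0 [ely el ey]]]]]] := map_eq_cat (esym eu).
rewrite {}ely in eu1; rewrite {}eu1 in ru *.
rewrite -el in rl; have [l1 r1 el1] := syllable_rel_lift ru rl.
have r : rewrites (syllable_rel m) (x0 ++ l0 ++ y0) (x0 ++ l1 ++ y0).
  exact/rewrites_catl/rewrites_catr.
have [||v0 rv0 ev0] := IH (x0 ++ l1 ++ y0).
- exact: (syllable_reduced_rewrites (syllable_valid_rewrites f_ge2 r) ru r).
- by rewrite !syllable_map_cat -el1 -ex -ey.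
by exists v0 => //; apply: rewrites_trans rv0.
Qed.

(** By lifting and injectivity of [phi], adjacent syllables of one generator in the image come from
    such a pair before mapping. *)
Lemma syllable_reduced_map u :
  syllable_reduced f m u -> syllable_reduced f' m' (syllable_map u).
Proof.
move=> ru; split; first by apply: syllable_valid_map; case: ru.
move=> w /syllable_lift /(_ u ru erefl) [v uv ->] x i a b y.
move=> /map_eq_cat [x0 [l [ev _ /(@map_eq_cat _ _ _ _ [:: _; _])]]].
case=> [l0 [y0 [el e _]]].
case: l0 el e => [|[i1 a1] [|[i2 b1] [|]]] //= el [e1 _ e2 _].
have /phi_inj e12 : phi i1 = phi i2 by rewrite e1 e2.
by apply: (proj2 ru v uv x0 i1 a1 b1 y0); rewrite ev el e12.
Qed.

End Comparison.

(** * The length-preserving injection *)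

Lemma dyer_le_m (n n' : nat) (m : 'I_n -> 'I_n -> natbar)
    (m' : 'I_n' -> 'I_n' -> natbar) (phi : 'I_n -> 'I_n') :
  (forall i j, i <> j -> le_natbar (Fin 2) (m i j)) ->
  (forall i j, i <> j -> le_natbar (Fin 2) (m' i j)) ->
  injective phi ->
  (forall i j, dyer_edge m i j -> dyer_edge m' (phi i) (phi j) /\
     le_natbar (m i j) (m' (phi i) (phi j))) ->
  forall i j, i <> j -> le_natbar (m i j) (m' (phi i) (phi j)).
Proof.
move=> m2 m2' phi_inj edge i j nij.
(* Off the edges of the Dyer graph [m i j] is 2, the least value that [m'] can take. *)
case e3 : (le_natbar (Fin 3) (m i j)); first by case: (edge i j).
have := m2 i j nij; have : phi i <> phi j by move/phi_inj.
move=> /m2'; move: e3; case: (m i j) (m' _ _) => [k|] [k'|] //=; lia.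
Qed.

Theorem dyer_le_injection (n n' : nat) (D D' : groupType)
    (s : 'I_n -> D) (f : 'I_n -> natbar) (m : 'I_n -> 'I_n -> natbar)
    (s' : 'I_n' -> D') (f' : 'I_n' -> natbar) (m' : 'I_n' -> 'I_n' -> natbar) :
  dyer_system s f m -> dyer_system s' f' m' -> dyer_le f m f' m' ->
  exists F : D -> D', injective F /\
    forall x, word_length s' (F x) = word_length s x.
Proof.
move=> hD hD' [phi [phi_inj edge phi_f]].
have phi_m := dyer_le_m (dyer_m_ge2 hD) (dyer_m_ge2 hD') phi_inj edge.
(* One reduced expression is fixed for each element. The map may depend on this choice, since a
   commutation in [D] can fail between the images in [D']. *)
have [U UP] := choice (ex_reduced hD).
have red x : syllable_reduced f' m' (syllable_map phi (U x)).
  have [rU _ _] := UP x.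
  apply: (syllable_reduced_map (f := f) (m := m)) => //.
  - exact: dyer_f_ge2 hD.
  - exact: dyer_m_sym hD.
  - exact: dyer_m_ge2 hD.
  - exact: dyer_m_ge2 hD'.
exists (fun x => syllable_eval s' (syllable_map phi (U x))); split; last first.
  move=> x; rewrite (word_length_reduced hD') // syllable_weight_map.
  by case: (UP x).
(* Equal images are joined by moves of [D'], which lift to moves of [D], and these preserve the
   element. *)
move=> x y /(syllable_reduced_eval_inj hD' (red x) (red y)) r.
have [rx ex _] := UP x; have [ry ey _] := UP y.
have [v uv /(syllable_map_inj phi_inj) ev] := syllable_lift (dyer_f_ge2 hD)
  (dyer_m_sym hD) (dyer_m_ge2 hD) (dyer_m_ge2 hD') phi_inj phi_m r rx erefl.
by rewrite -ex -ey ev; apply: (syllable_eval_rewrites hD).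
Qed.

(** * Growth *)

Section Fekete.
Local Open Scope ring_scope.
Local Open Scope classical_set_scope.
Variables (R : realType) (u : nat -> R).
Hypothesis u_ge0 : forall k, 0 <= u k.
Hypothesis u_mono : {homo u : k l / (k <= l)%N >-> k <= l}.
Hypothesis u_subadd : forall k l, u (k + l)%N <= u k + u l.

Lemma subadditive_mul q N r : u (q * N + r)%N <= q%:R * u N + u r.
Proof.
elim: q => [|q IH]; first by rewrite mul0n add0n mul0r add0r.
rewrite mulSn -addnA; apply: le_trans (u_subadd _ _) _.
by rewrite mulrS mulrDl mul1r -addrA lerD2l.
Qed.

(** The limit is the infimum of the quotients: writing $k = qN + r$ and bounding $u_r$ by $u_N$
    through monotonicity gives $u_k/k \le u_N/N + u_N/k$. *)
Lemma subadditive_cvg : cvg (k%:R^-1 * u k @[k --> \oo]).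
Proof.
pose E := [set y : R | exists2 k, (0 < k)%N & y = k%:R^-1 * u k].
have E0 : lbound E 0 by move=> _ [k _ ->]; rewrite mulr_ge0 ?invr_ge0.
have Einf : has_inf E by split; [exists (1%:R^-1 * u 1%N), 1%N|exists 0].
apply/cvg_ex; exists (inf E); apply/cvgrPdist_lt => e e0.
(* The quotient at [N] is within [e / 2] of the infimum; the other half is left for $u_N/k$. *)
have [_ [N N0 ->] hN] := inf_adherent (divr_gt0 e0 (ltr0Sn R 1)) Einf.
have N0' : 0 < N%:R :> R by rewrite ltr0n.
near=> k.
have k0 : (0 < k)%N by near: k; exact: nbhs_infty_gt.
have k0' : 0 < k%:R :> R by rewrite ltr0n.
have lower : inf E <= k%:R^-1 * u k by apply: ge_inf; [exists 0|exists k].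
have small : k%:R^-1 * u N < e / 2.
  rewrite mulrC ltr_pdivrMr // mulrC -ltr_pdivrMr ?divr_gt0 //.
  by near: k; exact: nbhs_infty_gtr.
have upper : u k <= (k %/ N)%:R * u N + u N.
  rewrite {1}(divn_eq k N); apply: le_trans (subadditive_mul _ _ _) _.
  by rewrite lerD2l u_mono // ltnW // ltn_mod.
have q : (k %/ N)%:R <= k%:R / N%:R :> R.
  by rewrite ler_pdivlMr // -natrM ler_nat leq_divM.
have : k%:R^-1 * u k <= N%:R^-1 * u N + k%:R^-1 * u N.
  rewrite mulrC ler_pdivrMr //; apply: le_trans upper _.
  rewrite mulrDl -[X in _ <= _ + X]mulrA [_ * k%:R in X in _ <= _ + X]mulrC.
  rewrite mulrA mulVf ?gt_eqF // mul1r lerD2r.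
  by rewrite mulrAC [_^-1 * _]mulrC ler_wpM2r.
move=> ub; rewrite ler0_norm ?subr_le0 // opprB ltrBlDr.
by rewrite addrC; apply: le_lt_trans ub _; lra.
Unshelve. all: by end_near.
Qed.

End Fekete.

Lemma submultiplicative_cvg (R : realType) (b : nat -> nat) :
  (forall k, 0 < b k)%N -> {homo b : k l / (k <= l)%N} ->
  (forall k l, b (k + l) <= b k * b l)%N ->
  cvg ((((b k)%:R `^ (k%:R^-1) : R)%R @[k --> \oo])%classic).
Proof.
move=> b0 bmono bsub.
have b0' k : (0 < (b k)%:R :> R)%R by rewrite ltr0n.
pose u k : R := ln (b k)%:R.
have /cvg_ex [l ul] : cvg ((k%:R^-1 * u k)%R @[k --> \oo])%classic.
  apply: subadditive_cvg => [k|k l kl|k l].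
  - by rewrite ln_ge0 // ler1n.
  - by rewrite ler_ln ?posrE // ler_nat bmono.
  - by rewrite -lnM ?posrE // ler_ln ?posrE ?mulr_gt0 // -natrM ler_nat.
apply/cvg_ex; exists (expR l).
rewrite (_ : (fun k => _) = expR \o (fun k => k%:R^-1 * u k)%R); last first.
  by apply/funext => k; rewrite /powR gt_eqF.
by apply: continuous_cvg ul; apply: continuous_expR.
Qed.

(** * Counting balls and spheres *)

Section Counting.
Local Open Scope classical_set_scope.

(** As [fset_set] sends an infinite set to the empty one, cardinalities are compared under
    finiteness. *)
Lemma card_fset_set_le (T U : choiceType) (F : T -> U) (A : set T) (B : set U) :
  finite_set A -> finite_set B -> injective F -> F @` A `<=` B ->
  #|` fset_set A|%fset <= #|` fset_set B|%fset.
Proof.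
move=> fA fB Finj AB.
have <- : #|` fset_set (F @` A)|%fset = #|` fset_set A|%fset.
  by rewrite (fset_set_image _ fA) card_imfset.
by apply: fsubset_leq_card; rewrite -fset_set_sub //; apply: finite_image.
Qed.

Variables (I : finType) (G : groupType) (s : I -> G).
Hypothesis gen : generates s.

Lemma finite_ball k : finite_set [set x : G | word_length s x <= k].
Proof.
apply: (@sub_finite_set _ _ ((fun t : k.-bseq (I * bool) => eval_word s t) @` setT)).
  move=> x /= xk; have [[w [sw ew]] _] := word_length_spec x gen.
  by rewrite -sw in xk; exists (Bseq xk).
exact/finite_image/finite_finset.
Qed.

Lemma finite_sphere k : finite_set [set x : G | word_length s x = k].
Proof. by apply: sub_finite_set (finite_ball k) => x /= ->. Qed.

Lemma ball_growth_gt0 k : 0 < ball_growth s k.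
Proof.
rewrite cardfs_gt0; apply/fset0Pn; exists 1%g.
rewrite in_fset_set ?inE /=; last exact: finite_ball.
have [_ h] := word_length_spec 1%g gen.
by have := h [::] (big_nil _ _ _ _); rewrite leqn0 => /eqP ->.
Qed.

Lemma ball_growth_mono : {homo ball_growth s : k l / k <= l}.
Proof.
move=> k l kl; apply: (@card_fset_set_le _ _ id); try exact: finite_ball.
  by [].
by move=> _ /= [x xk <-]; apply: leq_trans kl.
Qed.

(** Cutting a geodesic after [k] letters shows that the larger ball lies in the product of the two
    smaller ones. *)
Lemma ball_growth_submul k l :
  ball_growth s (k + l) <= ball_growth s k * ball_growth s l.
Proof.
rewrite /ball_growth -(size_allpairs (fun x y : G => (x * y)%g)).
apply: uniq_leq_size => [|x]; first exact: fset_uniq.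
rewrite in_fset_set ?inE /=; last exact: finite_ball.
move=> xkl; have [[w [sw ew]] _] := word_length_spec x gen.
apply/allpairsP; exists (eval_word s (take k w), eval_word s (drop k w)) => /=.
rewrite -eval_word_cat cat_take_drop ew; split=> //.
- rewrite in_fset_set ?inE /=; last exact: finite_ball.
  have [_ h1] := word_length_spec (eval_word s (take k w)) gen.
  apply: leq_trans (h1 _ erefl) _.
  by rewrite size_take; case: ltnP => //; lia.
- rewrite in_fset_set ?inE /=; last exact: finite_ball.
  have [_ h2] := word_length_spec (eval_word s (drop k w)) gen.
  apply: leq_trans (h2 _ erefl) _.
  by rewrite size_drop; lia.
Qed.

Lemma growth_rate_cvg (R : realType) :
  cvg (((ball_growth s k)%:R `^ (k%:R^-1) : R)%R @[k --> \oo]).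
Proof.
apply: submultiplicative_cvg; [exact: ball_growth_gt0|exact: ball_growth_mono|].
exact: ball_growth_submul.
Qed.

End Counting.

Theorem theorem2 (R : realType) (n n' : nat) (D D' : groupType)
    (s : 'I_n -> D) (f : 'I_n -> natbar) (m : 'I_n -> 'I_n -> natbar)
    (s' : 'I_n' -> D') (f' : 'I_n' -> natbar) (m' : 'I_n' -> 'I_n' -> natbar)
    (hD : dyer_system s f m) (hD' : dyer_system s' f' m')
    (hle : dyer_le f m f' m') :
  (forall k : nat, (sphere_growth s k <= sphere_growth s' k)%N) /\
  (growth_rate s R <= growth_rate s' R)%R.
Proof.
have [gen _] := dyer_presentation hD; have [gen' _] := dyer_presentation hD'.
have [F [F_inj F_len]] := dyer_le_injection hD hD' hle.
split=> [k|].
  apply: (card_fset_set_le (F := F)) => //; try exact: finite_sphere.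
  by move=> _ /= [x <- <-].
(* Convergence makes both values of [lim] genuine limits; the roots are then compared term by term,
   by restricting the injection to balls. *)
apply: ler_lim; try exact: growth_rate_cvg.
apply: nearW => k; apply: ge0_ler_powR; rewrite ?nnegrE ?invr_ge0 ?ler0n //.
rewrite ler_nat; apply: (card_fset_set_le (F := F)) => //; try exact: finite_ball.
by move=> _ /= [x xk <-]; rewrite F_len.
Qed.
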